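(* Let $k:=k(N)\le N$ be a positive function of $N$ such that $k\to\infty$ and $N-k\to\infty$ as $N\to\infty$. Let $\theta>0$, and suppose that for each $N$ the composition of the surplus capacity distribution function and the load surge function is $$F(l^N(i))=\frac{\theta+i-1+\Delta(i,N)}{N},$$ where $\Delta:\mathbb{N}\times\mathbb{N}\to\mathbb{R}$ satisfies the following properties: (A) $\Delta(i,N)\in[-(\theta+i-1),\,N-(\theta+i-1)]$ for every $(i,N)\in\mathbb{N}\times\mathbb{N}$; (B) for every fixed $N\in\mathbb{N}$, $\Delta(i+1,N)\ge\Delta(i,N)-1$ for all $i\in\mathbb{N}$; (C) $\Delta(i,N)\to\Delta(i)$ pointwise as $N\to\infty$ for some well-defined function $\Delta(\cdot):\mathbb{N}\to\mathbb{R}$ satisfying $\lim_{i\to\infty}\Delta(i)=0$; (D) for all $i(N)\le k$ satisfying $\lim_{N\to\infty}i(N)=\infty$, it holds that $\lim_{N\to\infty}\Delta(i(N),N)=0$. Then there exists a constant $V(\theta,\Delta)\in(0,\infty)$ (not depending on $k$) such that $$\lim_{N\to\infty}\sqrt{\frac{kN}{N-k}}\;\mathbb{P}(A^N\ge k)=V(\theta,\Delta).$$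
   Context: $\mathbb{N}=\{1,2,\dots\}$. Model. For each $N\in\mathbb{N}$ a network has $N$ lines with i.i.d. surplus capacities $C^N(1),\dots,C^N(N)$ having a common continuous distribution function $F$ with strictly positive density at zero. Let $C^N_{(1)}\le\dots\le C^N_{(N)}$ be the ordered surplus capacities. The load surge function $l^N(\cdot)$ is deterministic and increasing. The number of failed lines (blackout size) is $A^N=\max\{k\in\{1,\dots,N\}: C^N_{(i)}\le l^N(i)\text{ for all } i=1,\dots,k\}$, and $A^N=0$ if $C^N_{(1)}>l^N(1)$. Equivalently in distribution, $\mathbb{P}(A^N\ge k)=\mathbb{P}(U^N_{(i)}\le F(l^N(i)),\ i=1,\dots,k)$ for integers $1\le k\le N$, where $U^N_{(1)}\le\dots\le U^N_{(N)}$ are the order statistics of $N$ independent uniform random variables on $[0,1]$.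
   Formalization: Adds the assumption θ + Δ(1) > 0, where Δ(1) is the limit of Δ(1,N): if θ + Δ(1) = 0 (e.g. Δ(1,N) = −θ, so F(l^N(1)) = 0), the limit is 0 and no V in (0,∞) exists. *)

(* Defs.v *)
From HB Require Import structures.
From mathcomp Require Import all_boot all_order all_algebra.
From mathcomp Require Import all_classical all_reals all_analysis.
Set Implicit Arguments.
Unset Strict Implicit.
Unset Printing Implicit Defensive.
Import Order.TTheory GRing.Theory Num.Theory.
Import numFieldNormedType.Exports.
Local Open Scope classical_set_scope.
Local Open Scope ring_scope.

Definition mutually_independent (R : realType) (d : measure_display)
    (T : measurableType d) (P : probability T R) (I : finType)
    (X : I -> {RV P >-> R}) : Prop :=
  forall (J : {set I}) (B : I -> set R), (forall j, measurable (B j)) ->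
    P (\bigcap_(j in [set j | j \in J]) (X j @^-1` B j)) =
    (\prod_(j in J) P (X j @^-1` B j))%E.

Definition iid_with_cdf (R : realType) (d : measure_display)
    (T : measurableType d) (P : probability T R) (I : finType)
    (X : I -> {RV P >-> R}) (F : R -> R) : Prop :=
  mutually_independent X /\ forall (j : I) (x : R), cdf (X j) x = (F x)%:E.

(* For surplus capacities supported on [0, +oo[ the distribution function has
   a kink at 0, so the density there is taken to be the right derivative. *)
Definition positive_density_at_zero (R : realType) (F : R -> R) : Prop :=
  exists2 f0 : R, 0 < f0 & h^-1 * (F h - F 0) @[h --> 0^'+] --> f0.

(* Order statistics are numbered from 1: [order_stat c 1] is the minimum. *)
Definition order_stat (R : realType) (N : nat) (c : 'I_N -> R) (i : nat) : R :=
  nth 0 (sort <=%R [seq c j | j <- enum 'I_N]) i.-1.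

(* The condition holds vacuously for k = 0, so the maximum is 0 exactly when
   the smallest capacity exceeds l 1. *)
Definition blackout_size (R : realType) (N : nat) (l : nat -> R)
    (c : 'I_N -> R) : nat :=
  (\max_(k < N.+1 | [forall i : 'I_k, (order_stat c i.+1 <= l i.+1)%R]) k)%N.

(* Main.v *)
Require Import Defs.
From HB Require Import structures.
From mathcomp Require Import all_boot all_order all_algebra.
From mathcomp Require Import zify ring lra.
From mathcomp Require Import all_classical all_reals all_analysis.
Set Implicit Arguments.
Unset Strict Implicit.
Unset Printing Implicit Defensive.
Import Order.TTheory GRing.Theory Num.Theory.
Import numFieldNormedType.Exports.
Local Open Scope classical_set_scope.
Local Open Scope ring_scope.

(** Write F (l i) = x_i / N. The values of the capacities matter only through
the level crossed, so the event that the first k constraints hold is a finite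
disjoint union of rectangles, whose probability comes from a recursion over
the levels ([surv], [probability_all_levels]). With divided powers y^n/n! as
transition weights the recursion does not see N.

Affine boundaries tau + i, i = 0, 1, ..., are exactly solvable: the ballot
theorem gives the weight [passage] of paths that first fall below the boundary
at count j. This weight is harmonic for the recursion whatever the actual
boundary is, because it is a difference of two divided powers of a number that
does not depend on the current count. Abel's identity writes the constant
event as a sum over j of such weights, and therefore
  P(A >= k) = sum over k <= j <= N of [above_weight] tau N j *
              [surv_passage] x k tau j,
for every tau ([survivalE]). Passing from level k down to a fixed level m
loses only terms whose sign is that of tau + i - x_(i+1), i.e. of
(tau - theta) - Delta(i+1). As |Delta| <= eps between m and k, the choices
tau = theta + eps and tau = theta - eps bound P(A >= k) from above and below by
the same sum with m in place of k.

With m fixed, Stirling's formula with constant sigma shows that for large j and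
N - j the summands are asymptotic to a constant times the increments of
j |-> sqrt (1/j - 1/N), so the sum telescopes to
sqrt (1/k - 1/N) = ((kN)/(N-k))^(-1/2). The constant is 2/sigma times the
[mean_excess], the expected height above the boundary of the surviving limiting
Poisson path at level m. The mean excess changes from level i to level i + 1 by
delta(i+1) P(A = i), where delta is the limit of Delta. These changes are
summable, hence the mean excess converges; the limit is positive because, for
tau = theta - 1/4, the mean excess is positive and nondecreasing from some
level on. This yields V, which depends on theta and delta only. *)

(** * Divided powers, ballot weights and Abel's identity *)

Section divided_powers.
Context {R : realFieldType}.
Implicit Types (w y z t tau : R) (n c d j : nat).

Definition dpow n y : R := y ^+ n / n`!%:R.

Lemma fact_neq0R n : n`!%:R != 0 :> R.
Proof. by rewrite pnatr_eq0 -lt0n fact_gt0. Qed.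

Lemma dpow0 y : dpow 0 y = 1.
Proof. by rewrite /dpow fact0 expr0 divr1. Qed.

Lemma dpow_ge0 n y : 0 <= y -> 0 <= dpow n y.
Proof. by move=> y0; rewrite /dpow divr_ge0// exprn_ge0. Qed.

Lemma dpowD n w z :
  \sum_(p < n.+1) dpow p w * dpow (n - p) z = dpow n (w + z).
Proof.
rewrite /dpow addrC exprDn mulr_suml; apply: eq_bigr => p _.
have pn : (p <= n)%N by rewrite -ltnS.
have /(congr1 (fun m => m%:R : R)) := bin_fact pn.
rewrite !natrM => <-.
rewrite -[in RHS]mulr_natr.
have := fact_neq0R p; have := fact_neq0R (n - p).
have : 'C(n, p)%:R != 0 :> R by rewrite pnatr_eq0 -lt0n bin_gt0.
by move=> ? ? ?; field; apply/and3P; split.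
Qed.

(** Weight for the count of failed lines to go from d to c when the level rises
by w: the Poisson probability without its exponential factor. *)
Definition kern w d c : R := if (d <= c)%N then dpow (c - d) w else 0.

Lemma kern_refl w c : kern w c c = 1.
Proof. by rewrite /kern leqnn subnn dpow0. Qed.

Lemma kern_gt w d c : (c < d)%N -> kern w d c = 0.
Proof. by move=> cd; rewrite /kern leqNgt cd. Qed.

Lemma kern_ge0 w d c : 0 <= w -> 0 <= kern w d c.
Proof. by move=> w0; rewrite /kern; case: ifP => // _; exact: dpow_ge0. Qed.

(** Chapman-Kolmogorov: the binomial theorem for divided powers. *)
Lemma kernD N w z d j : (j <= N)%N ->
  \sum_(c < N.+1) kern w d c * kern z c j = kern (w + z) d j.
Proof.
move=> jN; have [dj|jd] := leqP d j; last first.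
  rewrite kern_gt// big1// => c _; have [dc|cd] := leqP d c.
    by rewrite (kern_gt _ (leq_trans jd dc)) mulr0.
  by rewrite kern_gt// mul0r.
have -> : kern (w + z) d j = dpow (j - d) (w + z) by rewrite /kern dj.
rewrite -dpowD.
rewrite -(big_mkord xpredT (fun c => kern w d c * kern z c j)).
rewrite (big_cat_nat (n := d)) //=; last exact: leqW (leq_trans dj jN).
rewrite [X in X + _]big_nat big1 ?add0r; last first.
  by move=> c /andP[_ cd]; rewrite kern_gt// mul0r.
rewrite (big_cat_nat (n := j.+1)) //=; last by rewrite ltnW.
rewrite [X in _ + X]big_nat [X in _ + X]big1 ?addr0; last first.
  by move=> c /andP[jc _]; rewrite (kern_gt _ jc) mulr0.
rewrite -{1}(add0n d) big_addn subSn// big_mkord; apply: eq_bigr => p _.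
have pj : (p <= j - d)%N by rewrite -ltnS.
rewrite /kern leq_addl addnK ifT; last by lia.
by rewrite addnC subnDA.
Qed.

(** For c < j this is u (u + n)^(n-1) / n! with n = j - c and u = tau + c - t
([passage_lt]), the ballot weight of paths with count c at level t that first
fall below the affine boundary tau + i at i = j. In the form of a difference
the argument tau + j - t is free of c, which makes harmonicity immediate. *)
Definition passage tau j t c : R :=
  kern (tau + j%:R - t) c j -
  (if j is j'.+1 then kern (tau + j%:R - t) c j' else 0).

Lemma passage_gt tau j t c : (j < c)%N -> passage tau j t c = 0.
Proof.
move=> jc; rewrite /passage kern_gt//; case: j jc => [|j] jc; rewrite ?subr0//.
by rewrite kern_gt ?subr0// ltnW.
Qed.

Lemma passage_refl tau c t : passage tau c t c = 1.
Proof.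
by rewrite /passage kern_refl; case: c => [|c]; rewrite ?subr0// kern_gt// subr0.
Qed.

Lemma passage_lt tau j t c : (c < j)%N ->
  passage tau j t c = (tau + c%:R - t) *
    ((tau + j%:R - t) ^+ (j - c).-1 / (j - c)`!%:R).
Proof.
case: j => // j; rewrite ltnS => cj.
rewrite /passage /kern cj (leqW cj) subSn//= /dpow.
have -> : j.+1%:R = (j - c)%:R + 1 + c%:R :> R.
  by rewrite natr1 -natrD addSn subnK.
rewrite factS natrM exprS.
have := fact_neq0R (j - c).
have : (j - c).+1%:R != 0 :> R by rewrite pnatr_eq0.
rewrite -natr1 => h0 h1; field; exact/andP.
Qed.

Lemma passage_ge0 tau j t c : t <= tau + c%:R -> 0 <= passage tau j t c.
Proof.
move=> tc; have [cj|jc|<-] := ltngtP c j.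
- rewrite passage_lt// mulr_ge0 ?subr_ge0// divr_ge0// exprn_ge0// subr_ge0.
  by rewrite (le_trans tc)// lerD2l ler_nat ltnW.
- by rewrite passage_gt.
- by rewrite passage_refl.
Qed.

Lemma passage_le0 tau j t c : (c < j)%N -> tau + c%:R <= t <= tau + j%:R ->
  passage tau j t c <= 0.
Proof.
move=> cj /andP[ct tj]; rewrite passage_lt// mulr_le0_ge0 ?subr_le0//.
by rewrite divr_ge0// exprn_ge0// subr_ge0.
Qed.

Lemma passage_homo tau tau' j t c : tau <= tau' -> t <= tau + c%:R ->
  passage tau j t c <= passage tau' j t c.
Proof.
move=> tt tc; have [cj|jc|<-] := ltngtP c j.
- have tj : t <= tau + j%:R by rewrite (le_trans tc)// lerD2l ler_nat ltnW.
  rewrite !passage_lt// ler_pM//.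
  + by rewrite subr_ge0.
  + by rewrite divr_ge0// exprn_ge0// subr_ge0.
  + by rewrite lerD2r lerD2r.
  + rewrite ler_pM2r ?invr_gt0 ?ltr0n ?fact_gt0//.
    rewrite lerXn2r ?nnegrE ?subr_ge0 ?lerD2r//.
    by rewrite (le_trans tj)// lerD2r.
- by rewrite !passage_gt.
- by rewrite !passage_refl.
Qed.

(** Both divided powers in the definition of [passage] satisfy
Chapman-Kolmogorov. *)
Lemma passage_harmonic N w tau j t d : (j <= N)%N ->
  \sum_(c < N.+1) kern w d c * passage tau j (t + w) c = passage tau j t d.
Proof.
move=> jN; rewrite /passage; under eq_bigr do rewrite mulrBr.
have -> : tau + j%:R - t = w + (tau + j%:R - (t + w)) by ring.
rewrite sumrB kernD//; congr (_ - _).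
case: j jN => [|j] jN; first by rewrite big1// => c _; rewrite mulr0.
by rewrite kernD// ltnW.
Qed.

(** The difference D of the two sides is harmonic and vanishes where the level
meets the boundary, at t = tau + c, since there all terms but j = c have a zero
factor. Moving the level there expresses D at count c through D at counts
larger than c, and induction on N - c gives D = 0. *)
Lemma abel_identity N tau t c : (c <= N)%N ->
  \sum_(j < N.+1) passage tau j t c * dpow (N - j) (N%:R - tau - j%:R) =
  kern (N%:R - t) c N.
Proof.
move=> cN; apply/eqP; rewrite eq_sym -subr_eq0.
pose D s b := kern (N%:R - s) b N -
  \sum_(j < N.+1) passage tau j s b * dpow (N - j) (N%:R - tau - j%:R).
rewrite -/(D t c).
have DK w s b : \sum_(e < N.+1) kern w b e * D (s + w) e = D s b.
  rewrite /D; under eq_bigr do rewrite mulrBr.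
  have -> : N%:R - s = w + (N%:R - (s + w)) by ring.
  rewrite sumrB kernD//; congr (_ - _).
  under eq_bigr do rewrite mulr_sumr; rewrite exchange_big/=.
  apply: eq_bigr => j _; rewrite -(@passage_harmonic N w)// -1?ltnS//.
  by rewrite mulr_suml; apply: eq_bigr => e _; rewrite mulrA.
have D0 b : (b <= N)%N -> D (tau + b%:R) b = 0.
  move=> bN; rewrite /D (bigD1 (inord b))//= inordK// passage_refl big1.
    by rewrite /kern bN mul1r addr0 opprD addrA subrr.
  move=> j jb; have [jltb|bltj|jeqb] := ltngtP j b.
  - by rewrite passage_gt// mul0r.
  - by rewrite passage_lt// subrr !mul0r.
  - by case/eqP: jb; apply/val_inj; rewrite /= inordK.
have [n] := ubnP (N - c); elim: n t c cN => // n IH t c cN.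
rewrite ltnS => cn.
rewrite -(DK (tau + c%:R - t)) big1// => e _.
have [ec|ce|->] := ltngtP e c.
- by rewrite kern_gt// mul0r.
- have eN := ltn_ord e; rewrite ltnS in eN.
  by rewrite (eqP (IH _ _ eN _)) ?mulr0//; lia.
- by rewrite [t + _]addrC subrK D0// mulr0.
Qed.

(** * Paths above a general boundary *)

(** Weight of the histories that have c failed lines at level x i and have
fulfilled the first i constraints; the factor e^(-x i) is left out. *)
Fixpoint surv (x : nat -> R) i c : R :=
  if i is i'.+1 then
    if (i' < c)%N then
      \sum_(d < c.+1) surv x i' d * kern (x i - x i') d c
    else 0
  else (c == 0)%:R.

Lemma surv_lt x i c : (c < i)%N -> surv x i c = 0.
Proof. by case: i => // i; rewrite ltnS /= ltnNge => ->. Qed.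

Lemma surv_ge0 x i c : (forall i', (i' < i)%N -> x i' <= x i'.+1) ->
  0 <= surv x i c.
Proof.
elim: i c => [|i IH] c xle /=; first exact: ler0n.
case: ifP => // _; apply: sumr_ge0 => d _; apply: mulr_ge0.
  by apply: IH => i' i'i; rewrite xle// ltnW.
by rewrite kern_ge0// subr_ge0 xle.
Qed.

(** Optional stopping over one level: a harmonic function loses exactly its
value on the histories killed at this step, which have count i. *)
Lemma surv_step (x : nat -> R) N i (phi phi' : nat -> R) : (i <= N)%N ->
  (forall d, (d <= N)%N ->
    phi d = \sum_(c < N.+1) kern (x i.+1 - x i) d c * phi' c) ->
  \sum_(c < N.+1) surv x i c * phi c =
  \sum_(c < N.+1) surv x i.+1 c * phi' c + surv x i i * phi' i.
Proof.
move=> iN phiE.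
transitivity (\sum_(c < N.+1)
    (\sum_(d < N.+1) surv x i d * kern (x i.+1 - x i) d c) * phi' c).
  under eq_bigr => d _ do rewrite (phiE _ (leq_ord d)) mulr_sumr.
  rewrite exchange_big/=; apply: eq_bigr => c _; rewrite mulr_suml.
  by apply: eq_bigr => d _; rewrite mulrA.
rewrite [LHS](bigD1 (inord i))//= inordK// [RHS]addrC; congr (_ + _).
  congr (_ * _); rewrite (bigD1 (inord i))//= inordK// kern_refl mulr1.
  rewrite big1 ?addr0// => d di; have [dlti|iltd|deqi] := ltngtP d i.
  - by rewrite surv_lt// mul0r.
  - by rewrite kern_gt// mulr0.
  - by case/eqP: di; apply/val_inj; rewrite /= inordK.
rewrite [RHS](bigD1 (inord i))//= inordK// ltnn mul0r add0r.
apply: eq_bigr => c ci; congr (_ * _).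
have [ic|ltci|ceqi] := ltngtP i c.
- rewrite [RHS](big_ord_widen N.+1 (fun d => surv x i d * kern (x i.+1 - x i) d c))//.
  rewrite [LHS](bigID (fun d : 'I__ => (d < c.+1)%N))/=.
  rewrite [X in _ + X]big1 ?addr0// => d; rewrite -leqNgt => cd.
  by rewrite kern_gt// mulr0.
- rewrite big1// => d _; have [di|id'] := ltnP d i.
    by rewrite surv_lt// mul0r.
  by rewrite kern_gt ?mulr0// (leq_trans ltci).
- by case/eqP: ci; apply/val_inj; rewrite /= inordK.
Qed.

(** By [sum_surv_passage] this is the sum of [surv] x m c * [passage] tau j (x m) c
over c. In the present form it has a number of terms that does not grow with j,
so limits in j can be taken term by term. *)
Definition surv_passage (x : nat -> R) m tau j : R :=
  passage tau j 0 0 - \sum_(i < m) surv x i i * passage tau j (x i.+1) i.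

Lemma sum_surv_passage (x : nat -> R) N m tau j :
  x 0%N = 0 -> (m <= N.+1)%N -> (j <= N)%N ->
  \sum_(c < N.+1) surv x m c * passage tau j (x m) c = surv_passage x m tau j.
Proof.
move=> x0 mN jN; elim: m mN => [|m IH] mN.
  rewrite /surv_passage big_ord0 subr0 big_ord_recl/= mul1r x0 big1 ?addr0// => i _.
  by rewrite mul0r.
have := IH (ltnW mN).
rewrite (@surv_step _ _ _ _ (passage tau j (x m.+1)))//; last first.
  move=> d dN; rewrite -(@passage_harmonic N (x m.+1 - x m))//.
  by rewrite [x m + _]addrC subrK.
by move=> /(canRL (addrK _)) ->; rewrite /surv_passage big_ord_recr/= opprD addrA.
Qed.

Lemma sum_surv_kern (x : nat -> R) N m : x 0%N = 0 -> (m <= N.+1)%N ->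
  \sum_(c < N.+1) surv x m c * kern (N%:R - x m) c N =
  dpow N N%:R - \sum_(i < m) surv x i i * kern (N%:R - x i.+1) i N.
Proof.
move=> x0; elim: m => [|m IH] mN.
  rewrite big_ord0 subr0 big_ord_recl/= mul1r x0 big1 ?addr0 => [|i _].
    by rewrite /kern subn0 subr0.
  by rewrite mul0r.
have := IH (ltnW mN).
rewrite (@surv_step _ _ _ (fun c => kern (N%:R - x m) c N)
  (fun c => kern (N%:R - x m.+1) c N))//; last first.
  move=> d dN; rewrite kernD//; congr (kern _ _ _); ring.
by move=> /(canRL (addrK _)) ->; rewrite big_ord_recr/= opprD addrA.
Qed.

(** For c >= k only the terms with j >= k of Abel's identity survive. *)
Lemma survival_expansion (x : nat -> R) N k tau :
  x 0%N = 0 -> (k <= N)%N ->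
  \sum_(c < N.+1) surv x k c * kern (N%:R - x k) c N =
  \sum_(k <= j < N.+1) dpow (N - j) (N%:R - tau - j%:R) * surv_passage x k tau j.
Proof.
move=> x0 kN.
under eq_bigr => c _ do rewrite -(abel_identity tau _ (leq_ord c)) mulr_sumr.
rewrite exchange_big/=.
transitivity (\sum_(j < N.+1)
    dpow (N - j) (N%:R - tau - j%:R) * surv_passage x k tau j *+ (k <= j)%N).
  apply: eq_bigr => j _.
  have jN : (j <= N)%N by rewrite -ltnS.
  under eq_bigr do rewrite mulrA; rewrite -mulr_suml mulrC.
  have [kj|jk] := leqP k j; first by rewrite mulr1n sum_surv_passage// leqW.
  rewrite mulr0n big1 ?mulr0// => c _.
  have [cj|jc] := leqP c j; last by rewrite passage_gt// mulr0.
  by rewrite surv_lt ?mul0r// (leq_ltn_trans cj).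
rewrite -(big_mkord xpredT (fun j =>
  dpow (N - j) (N%:R - tau - j%:R) * surv_passage x k tau j *+ (k <= j)%N)).
rewrite (big_cat_nat (n := k))//=; last exact: leqW.
rewrite [X in X + _]big_nat big1 ?add0r.
  by rewrite !big_nat; apply: eq_bigr => j /andP[-> _]; rewrite mulr1n.
by move=> j /andP[_]; rewrite ltnNge => /negbTE ->; rewrite mulr0n.
Qed.

(** The killed terms between the levels m and n are nonnegative when the actual
boundary lies below the affine one. *)
Lemma surv_passage_le (x : nat -> R) m n tau j : (m <= n)%N ->
  (forall i, (i < n)%N -> x i <= x i.+1) ->
  (forall i, (m <= i < n)%N -> x i.+1 <= tau + i%:R) ->
  surv_passage x n tau j <= surv_passage x m tau j.
Proof.
move=> mn xle xtau; rewrite /surv_passage lerD2l lerN2.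
rewrite -!(big_mkord xpredT (fun i => surv x i i * passage tau j (x i.+1) i)).
rewrite [leRHS](big_cat_nat (n := m))//= lerDl big_nat sumr_ge0// => i /andP[mi jn].
rewrite mulr_ge0 ?passage_ge0 ?xtau ?mi// surv_ge0// => i' i'i.
by rewrite xle// (ltn_trans i'i).
Qed.

(** The upper bound tau + i + 1 on the boundary keeps the base of the power in
[passage] nonnegative. *)
Lemma surv_passage_ge (x : nat -> R) m n tau j : (m <= n <= j)%N ->
  (forall i, (i < n)%N -> x i <= x i.+1) ->
  (forall i, (m <= i < n)%N -> tau + i%:R <= x i.+1 <= tau + i.+1%:R) ->
  surv_passage x m tau j <= surv_passage x n tau j.
Proof.
move=> /andP[mn nj] xle xtau; rewrite /surv_passage lerD2l lerN2.
rewrite -!(big_mkord xpredT (fun i => surv x i i * passage tau j (x i.+1) i)).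
rewrite [leLHS](big_cat_nat (n := m))//= gerDl big_nat sumr_le0// => i /andP[mi jn].
have ij : (i < j)%N by rewrite (leq_trans jn).
rewrite mulr_ge0_le0 ?passage_le0//.
  by rewrite surv_ge0// => i' i'i; rewrite xle// (ltn_trans i'i).
have /andP[-> h] : tau + i%:R <= x i.+1 <= tau + i.+1%:R by rewrite xtau// mi.
by rewrite (le_trans h)// lerD2l ler_nat.
Qed.

Lemma surv_passage_ge0_homo (x : nat -> R) k tau tau' j : x 0%N = 0 ->
  (forall i, (i < k)%N -> x i <= x i.+1) -> x k <= tau + k%:R -> tau <= tau' ->
  (k <= j)%N ->
  0 <= surv_passage x k tau j <= surv_passage x k tau' j.
Proof.
move=> x0 xle xk tt kj; rewrite -!(@sum_surv_passage _ j)//; try exact: leqW.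
have H (c : nat) : (k <= c)%N -> x k <= tau + c%:R.
  by move=> kc; rewrite (le_trans xk)// lerD2l ler_nat.
apply/andP; split; [apply: sumr_ge0 => c _|apply: ler_sum => c _].
  have [ck|/H kc] := ltnP c k; first by rewrite surv_lt ?mul0r.
  by rewrite mulr_ge0 ?surv_ge0// passage_ge0.
have [ck|/H kc] := ltnP c k; first by rewrite surv_lt ?mul0r.
by rewrite ler_wpM2l ?surv_ge0// passage_homo.
Qed.

Lemma surv_passage_ge_survivor (x : nat -> R) m tau j : x 0%N = 0 ->
  (forall i, (i < m)%N -> x i <= x i.+1) -> x m <= tau + m%:R -> (m <= j)%N ->
  surv x m m * passage tau j (x m) m <= surv_passage x m tau j.
Proof.
move=> x0 xle xm mj; rewrite -!(@sum_surv_passage _ j)//; last exact: leqW.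
have mj1 : (m < j.+1)%N by [].
rewrite (bigD1 (Ordinal mj1))//= lerDl sumr_ge0// => c _.
have [ck|kc] := ltnP c m; first by rewrite surv_lt ?mul0r.
by rewrite mulr_ge0 ?surv_ge0// passage_ge0// (le_trans xm)// lerD2l ler_nat.
Qed.

Lemma surv_gt0 (x : nat -> R) m : x 0%N = 0 -> 0 < x 1%N ->
  (forall i, (i < m)%N -> x i <= x i.+1) ->
  forall c, (m <= c)%N -> (0 < m)%N -> 0 < surv x m c.
Proof.
move=> x0 x1; case: m => // m; elim: m => [|m IH] xle c mc _.
  rewrite /= mc big_ord_recl big1 /= => [|i _]; last by rewrite mul0r.
  by rewrite mul1r addr0 x0 subr0 /kern /dpow divr_gt0// ?exprn_gt0// ltr0n fact_gt0.
have -> : surv x m.+2 c = \sum_(d < c.+1) surv x m.+1 d * kern (x m.+2 - x m.+1) d c.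
  by rewrite [LHS]/= mc.
have xle' i : (i < m.+1)%N -> x i <= x i.+1 by move=> im; rewrite xle// ltnW.
rewrite big_ord_recr/= ltr_wpDl//.
  by apply: sumr_ge0 => d _; rewrite mulr_ge0 ?(surv_ge0 _ xle')//
    kern_ge0// subr_ge0 xle.
by rewrite kern_refl mulr1; apply: IH => //; exact: ltnW.
Qed.

End divided_powers.

(** * From order statistics to the level recursion *)

Lemma order_stat_le (R : realType) N (c : 'I_N -> R) i v : (i < N)%N ->
  (order_stat c i.+1 <= v) = (i < #|[set j | (c j <= v)%R]%SET|)%N.
Proof.
move=> iN; rewrite /order_stat /=; set s := sort _ _.
have ss : sorted <=%R s by exact: sort_le_sorted.
have szs : size s = N by rewrite size_sort size_map size_enum_ord.
have -> : #|[set j | (c j <= v)%R]%SET| = count (<= v) s.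
  rewrite (permP (permEl (perm_sort _ _))) count_map cardE -size_filter.
  rewrite /enum_mem -filter_predI; congr (size _).
  by apply: eq_filter => j; rewrite !inE andbT.
apply/idP/idP => [|ic]; last exact: nth_count_le.
by apply: contraTT; rewrite -leqNgt -ltNge => h; rewrite nth_count_gt// szs h iN.
Qed.

Lemma leq_blackout_size (R : realType) N (l : nat -> R) (c : 'I_N -> R) k :
  (k <= N)%N ->
  (k <= blackout_size l c)%N =
  [forall i : 'I_k, (i < #|[set j | (c j <= l i.+1)%R]%SET|)%N].
Proof.
move=> kN; apply/idP/idP.
- case: k kN => [|k] kN; first by move=> _; apply/forallP => -[].
  move=> kA; apply/forallP => i; apply: contraLR kA => iS.
  rewrite -leqNgt; apply/bigmax_leqP => m /forallP mP.
  rewrite leqNgt; apply: contra iS => km.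
  have im : (i < m)%N by exact: leq_trans (ltn_ord i) km.
  have /= := mP (Ordinal im); rewrite order_stat_le//.
  by rewrite (leq_trans im)// -ltnS.
- move=> H; apply: (@leq_bigmax_cond _ _ (fun m : 'I_N.+1 => nat_of_ord m)
    (Ordinal (kN : k < N.+1)%N)).
  apply/forallP => i /=; rewrite order_stat_le; last exact: leq_trans (ltn_ord i) kN.
  exact: (forallP H).
Qed.

Lemma sum_subsets (R : nzRingType) (T : finType) (S : {set T}) (g : nat -> R) :
  \sum_(S' : {set T} | S' \subset S) g #|S'| =
  \sum_(d < #|S|.+1) 'C(#|S|, d)%:R * g d.
Proof.
rewrite (partition_big (fun S' : {set T} => inord #|S'| : 'I_#|S|.+1) xpredT)//=.
apply: eq_bigr => d _; rewrite -cards_draws.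
rewrite (eq_bigr (fun _ => g d)); last first.
  by move=> S' /andP[/subset_leq_card SS' /eqP <-]; rewrite inordK.
rewrite sumr_const mulr_natl; congr (_ *+ _); apply: eq_card => S'.
rewrite !inE unfold_in; case SS' : (_ \subset _) => //=.
by rewrite -(inj_eq val_inj)/= inordK// ltnS subset_leq_card.
Qed.

Lemma measure_finType_bigcup (R : realType) d (T : measurableType d)
    (mu : {measure set T -> \bar R}) (I : finType) (Q : {pred I})
    (E : I -> set T) :
  (forall i, Q i -> measurable (E i)) -> trivIset [set` Q] E ->
  measurable (\bigcup_(i in [set` Q]) E i) /\
  mu (\bigcup_(i in [set` Q]) E i) = (\sum_(i | Q i) mu (E i))%E.
Proof.
move=> mE tE; split; first exact: fin_bigcup_measurable.
rewrite measure_fin_bigcup// [RHS]bigfs ?index_enum_uniq// => i _.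
by rewrite mem_index_enum.
Qed.

Section survival_probability.
Context (R : realType) d (T : measurableType d) (P : probability T R).
Context (N : nat) (X : 'I_N -> {RV P >-> R}) (l : nat -> R).

Definition level i : set R := if i is 0 then set0 else `]-oo, l i]%classic.

Lemma measurable_level i : measurable (level i).
Proof. by case: i => [|i]; [exact: measurable0|exact: measurable_itv]. Qed.

(** The event that the first i constraints hold, that the lines of S lie below
level i and that the capacities of the other lines are in prescribed sets. The
free sets B are what makes an induction on i go through independence. *)
Definition survivors i (S : {set 'I_N}) (B : 'I_N -> set R) : set T :=
  [set t | (forall i', (i' < i)%N ->
             (i' < #|[set j | (X j t <= l i'.+1)%R]%SET|)%N) /\
           forall j, (if j \in S then level i else B j) (X j t)].

(** Induction on i: split according to the set S' of lines that are already
below level i. The lines of S outside S' lie between the levels i and i + 1. *)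
Lemma probability_survivors (k : nat) (x : nat -> R) :
  mutually_independent X ->
  (forall i, (i < k)%N -> level i `<=` level i.+1) ->
  (forall i j, (i < k)%N -> P (X j @^-1` (level i.+1 `\` level i)) =
                            ((x i.+1 - x i) / N%:R)%:E) ->
  forall i, (i <= k)%N -> forall (S : {set 'I_N}) (B : 'I_N -> set R),
    (forall j, measurable (B j)) -> (forall j, B j `&` level i = set0) ->
    measurable (survivors i S B) /\
    P (survivors i S B) = ((#|S|)`!%:R / N%:R ^+ #|S| * surv x i #|S| *
      \prod_(j | j \notin S) fine (P (X j @^-1` B j)))%:E.
Proof.
move=> indep lle lP; elim => [|i IH] ik S B mB Bl.
  have [->|/finset.set0Pn[j jS]] := eqVneq S finset.set0; last first.
    have -> : survivors 0 S B = set0.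
      by apply/seteqP; split => // t [_ /(_ j)]; rewrite jS.
    split; first exact: measurable0.
    rewrite measure0 /= cards_eq0; case: eqP => [S0|_]; last first.
      by rewrite mulr0 mul0r.
    by move: jS; rewrite S0 inE.
  have -> : survivors 0 finset.set0 B =
      \bigcap_(j in [set j | j \in [set: 'I_N]%SET]) (X j @^-1` B j).
    apply/seteqP; split => [t [_ h] j _|t h].
      by have := h j; rewrite inE.
    by split => // j; rewrite inE; apply: h; rewrite /= inE.
  split.
    by apply: fin_bigcap_measurable => // j _; exact: measurable_funPTI.
  rewrite indep// cards0 fact0 expr0 divr1 /= !mul1r.
  rewrite (big_morph EFin (@EFinM R) erefl).
  apply: eq_big => [j|j _]; first by rewrite !inE.
  by rewrite fineK// fin_num_measure//; exact: measurable_funPTI.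
have mD j : measurable (if j \in S then level i.+1 `\` level i else B j).
  by case: ifP => // _; apply: measurableD; exact: measurable_level.
have [Si|iS] := leqP #|S| i.
  have -> : survivors i.+1 S B = set0.
    apply/seteqP; split => // t [/(_ i (ltnSn i)) h1 h2]; move: h1.
    apply/negP; rewrite -leqNgt (leq_trans _ Si)// subset_leq_card//.
    apply/fintype.subsetP => j; rewrite inE => jl.
    have := h2 j; case: ifPn => // _ Bj.
    suff : (B j `&` level i.+1) (X j t) by rewrite Bl.
    by split => //=; rewrite in_itv.
  split; first exact: measurable0.
  by rewrite measure0 surv_lt ?ltnS// mulr0 mul0r.
pose B' j := if j \in S then level i.+1 `\` level i else B j.
have B'l j : B' j `&` level i = set0.
  rewrite /B'; case: ifP => _; first by rewrite setDKI.
  apply/seteqP; split => // r [Br rl].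
  by rewrite -[X in X r](Bl j); split => //; exact: lle rl.
have IHS (S' : {set 'I_N}) := IH (ltnW ik) S' B' mD B'l.
have -> : survivors i.+1 S B =
    \bigcup_(S' in [set` [pred S' : {set 'I_N} | S' \subset S]])
      survivors i S' B'.
  apply/seteqP; split => t.
    move=> [h1 h2]; pose S' := [set j in S | `[< level i (X j t) >] ]%SET.
    exists S' => /=.
      by rewrite inE; apply/fintype.subsetP => j; rewrite inE => /andP[].
    split => [i' i'i|j]; first by rewrite h1// ltnW.
    have := h2 j; rewrite inE /B'; case: ifP => //= jS lj.
    by case: (pselect (level i (X j t))) => h; [rewrite asboolT|rewrite asboolF].
  move=> [S' /=]; rewrite inE => S'S [h1 h2].
  have h j : (if j \in S then level i.+1 else B j) (X j t).
    have := h2 j; rewrite /B'; case: ifP => [/(fintype.subsetP S'S) ->|_].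
      exact: lle.
    by case: ifP => // _ [].
  split => // i'; rewrite ltnS leq_eqVlt => /predU1P[->|]; last exact: h1.
  rewrite (leq_trans iS)// subset_leq_card//; apply/fintype.subsetP => j jS.
  by have := h j; rewrite jS inE /= in_itv.
have tS : trivIset [set` [pred S' : {set 'I_N} | S' \subset S]]
    (fun S' => survivors i S' B').
  move=> S1 S2 _ _ [t [[_ h1] [_ h2]]]; apply/setP => j.
  have := h1 j; have := h2 j.
  case: ifP => _; case: ifP => _ // a b.
    by have : (B' j `&` level i) (X j t) by []; rewrite B'l.
  by have : (B' j `&` level i) (X j t) by []; rewrite B'l.
have [|m ->] := @measure_finType_bigcup _ _ _ P _
    [pred S' : {set 'I_N} | S' \subset S] (fun S' => survivors i S' B') _ tS.
  by move=> S' _; have [] := IHS S'.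
split => //; rewrite (eq_bigr _ (fun S' _ => (IHS S').2)) sumEFin; congr EFin.
set w := (x i.+1 - x i) / N%:R; set Q := \prod_(j | j \notin S) _.
have N0 : N%:R != 0 :> R.
  have := leq_trans iS (max_card (mem S)); rewrite card_ord => iN.
  by rewrite pnatr_eq0 -lt0n (leq_ltn_trans _ iN).
have prodE (S' : {set 'I_N}) : S' \subset S ->
    \prod_(j | j \notin S') fine (P (X j @^-1` B' j)) = w ^+ (#|S| - #|S'|) * Q.
  move=> S'S; rewrite (bigID (mem S))/=; congr (_ * _).
    rewrite (eq_bigr (fun=> w)) => [|j /andP[_ jS]]; last first.
      by rewrite /B' jS lP.
    rewrite prodr_const; congr (_ ^+ _).
    have /finset.setIidPr S'E := S'S.
    by rewrite -{2}S'E -cardsD; apply: eq_card => j; rewrite !inE.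
  apply: eq_big => [j|j /andP[_ /negbTE jS]]; last by rewrite /B' jS.
  by rewrite andb_idl//; apply: contra; exact/fintype.subsetP.
pose g d' := d'`!%:R / N%:R ^+ d' * surv x i d' * w ^+ (#|S| - d').
transitivity (\sum_(S' : {set 'I_N} | S' \subset S) g #|S'| * Q).
  by apply: eq_bigr => S' S'S; rewrite prodE// mulrA.
rewrite -mulr_suml sum_subsets; congr (_ * _).
rewrite /= iS mulr_sumr; apply: eq_bigr => d' _.
have d'S : (d' <= #|S|)%N by rewrite -ltnS.
rewrite /g /kern /dpow d'S /w exprMn exprVn.
rewrite -[in RHS](bin_fact d'S) !natrM.
have -> : N%:R ^+ #|S| = N%:R ^+ d' * N%:R ^+ (#|S| - d') :> R.
  by rewrite -exprD subnKC.
have h1 : N%:R ^+ d' != 0 :> R by rewrite expf_neq0.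
have h2 : N%:R ^+ (#|S| - d') != 0 :> R by rewrite expf_neq0.
have h3 := @fact_neq0R R (#|S| - d').
by field; apply/and3P.
Qed.

(** The free sets are the complement of level k, and one sums over S. *)
Lemma probability_all_levels (k : nat) (x : nat -> R) :
  (k <= N)%N -> x 0%N = 0 ->
  mutually_independent X ->
  (forall i, (i < k)%N -> level i `<=` level i.+1) ->
  (forall i j, (0 < i <= k)%N -> P (X j @^-1` (level i)) = (x i / N%:R)%:E) ->
  P [set t | (k <= blackout_size l (X ^~ t))%N] =
  (N`!%:R / N%:R ^+ N *
    \sum_(c < N.+1) surv x k c * kern (N%:R - x k) c N)%:E.
Proof.
move=> kN x0 indep lle lP.
have lP0 i j : (i <= k)%N -> P (X j @^-1` (level i)) = (x i / N%:R)%:E.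
  case: i => [|i] ik; last by rewrite lP.
  by rewrite [level 0]/(set0) preimage_set0 measure0 x0 mul0r.
have mX i j : measurable (X j @^-1` level i).
  by apply: measurable_funPTI => //; exact: measurable_level.
have lPD i j : (i < k)%N -> P (X j @^-1` (level i.+1 `\` level i)) =
                            ((x i.+1 - x i) / N%:R)%:E.
  move=> ik.
  transitivity (P (X j @^-1` level i.+1) - P (X j @^-1` level i))%E.
    have fin : (P (X j @^-1` level i.+1) < +oo)%E by rewrite ltey_eq fin_num_measure.
    rewrite (_ : X j @^-1` (level i.+1 `\` level i) =
      (X j @^-1` level i.+1) `\` (X j @^-1` level i))//.
    apply: (etrans (measureD (mX i.+1 j) (mX i j) fin)).
    by congr (_ - P _)%E; apply/setIidPr => t; exact: lle.
  by rewrite (lP0 i.+1 j ik) (lP0 i j (ltnW ik)) -EFinB mulrBl.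
have main := @probability_survivors k x indep lle lPD k (leqnn k) _ (fun=> ~` level k)
   (fun _ => measurableC (measurable_level k)) (fun _ => setICl _).
have -> : [set t | (k <= blackout_size l (X ^~ t))%N] =
    \bigcup_(S in [set` [pred S : {set 'I_N} | true]]) survivors k S (fun=> ~` level k).
  apply/seteqP; split => t /=; rewrite leq_blackout_size//.
    move=> /forallP h; exists [set j | `[< level k (X j t) >] ]%SET => //=.
    split => [i' i'k|j]; first exact: (h (Ordinal i'k)).
    by rewrite inE; case: (pselect (level k (X j t))) => g; [rewrite asboolT|rewrite asboolF].
  by move=> [S _ [h _]]; apply/forallP => i; apply: h.
have [||m ->] := @measure_finType_bigcup _ _ _ P _
    [pred S : {set 'I_N} | true] (fun S => survivors k S (fun=> ~` level k)).
- by move=> S _; have [] := main S.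
- move=> S1 S2 _ _ [t [[_ h1] [_ h2]]]; apply/setP => j.
  have := h1 j; have := h2 j.
  by case: ifP => _; case: ifP.
rewrite (eq_bigr _ (fun S _ => (main S).2)) sumEFin; congr EFin.
pose g d' := d'`!%:R / N%:R ^+ d' * surv x k d' * (1 - x k / N%:R) ^+ (N - d').
transitivity (\sum_(S : {set 'I_N} | S \subset [set: 'I_N]%SET) g #|S|).
  apply: eq_big => [S|S _]; first by rewrite finset.subsetT.
  rewrite /g; congr (_ * _).
  rewrite (eq_bigr (fun=> 1 - x k / N%:R)) => [|j _].
    rewrite prodr_const; congr (_ ^+ _).
    have SC : (#|S| + #|~: S|)%N = N by rewrite cardsC card_ord.
    transitivity (#|S| + #|~: S| - #|S|)%N; last by rewrite SC.
    by rewrite addKn; apply: eq_card => j; rewrite !inE.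
  suff -> : P (X j @^-1` (~` level k)) = (1 - x k / N%:R)%:E by [].
  transitivity (1 - P (X j @^-1` level k))%E.
    exact: (probability_setC P (mX k j)).
  by rewrite (lP0 k j (leqnn k)) -EFinB.
rewrite sum_subsets cardsT card_ord mulr_sumr.
apply: eq_bigr => d' _.
have d'N : (d' <= N)%N by rewrite -ltnS.
rewrite /g /kern /dpow d'N -(bin_fact d'N) !natrM.
case: (posnP N) => [N0|Npos].
  have -> : (d' : nat) = 0%N by apply/eqP; rewrite -leqn0 -N0.
  by rewrite N0 !subn0 bin0 fact0 !expr0 !divr1 !mul1r.
have h0 : N%:R != 0 :> R by rewrite pnatr_eq0 -lt0n.
have -> : N%:R - x k = N%:R * (1 - x k / N%:R) by field.
have -> : N%:R ^+ N = N%:R ^+ d' * N%:R ^+ (N - d') :> R.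
  by rewrite -exprD subnKC.
rewrite exprMn.
have h1 : N%:R ^+ d' != 0 :> R by rewrite expf_neq0.
have h2 : N%:R ^+ (N - d') != 0 :> R by rewrite expf_neq0.
have h3 := @fact_neq0R R (N - d').
by field; apply/and3P.
Qed.

End survival_probability.

(** * Stirling's formula up to the value of the constant *)

Section stirling.
Context {R : realType}.
Implicit Types y : R.

Lemma ge0_of_derive_ge0 (f f' : R -> R) y :
  (forall z : R, 0 <= z -> is_derive z (1 : R) f (f' z)) ->
  (forall z, 0 <= z -> 0 <= f' z) -> f 0 = 0 -> 0 <= y -> 0 <= f y.
Proof.
move=> df f'0 f0 y0; rewrite -f0.
apply: (@ger0_derive1_ndecr _ _ 0 y) => //.
- by move=> z /[!in_itv]/= /andP[/ltW z0 _]; have [] := df _ z0.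
- move=> z /[!in_itv]/= /andP[/ltW z0 _]; rewrite derive1E.
  by have [_ ->] := df _ z0; exact: f'0.
- apply: derivable_within_continuous => z /[!in_itv]/= /andP[z0 _].
  by have [] := df _ z0.
Qed.

Lemma is_derive_ln1D y : 0 <= y -> is_derive y 1 (fun z => ln (1 + z)) (1 + y)^-1.
Proof.
move=> y0; have y1 : 0 < 1 + y by rewrite ltr_wpDr.
have dln := is_derive1_ln y1.
have d1 : is_derive y 1 (fun z : R => 1 + z) 1.
  by apply: is_derive_eq; rewrite add0r mulr1.
have := @is_derive1_comp _ (@ln R) (fun z => 1 + z) y _ _ dln d1.
by rewrite mulr1.
Qed.

Lemma ln1D_ge y : - 1 < y -> y / (1 + y) <= ln (1 + y).
Proof.
move=> yN1; have y1 : 0 < 1 + y by rewrite -ltrBlDl sub0r.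
rewrite -[leRHS]opprK lerNr -lnV ?posrE//.
rewrite [X in ln X](_ : _ = 1 + - (y / (1 + y))); last first.
  by field; rewrite gt_eqF.
by rewrite le_ln1Dx// ltrN2 ltr_pdivrMr// mul1r ltrDr.
Qed.

Lemma mulr_ln1D_ge y : 0 <= y -> 2 * y <= (2 + y) * ln (1 + y).
Proof.
move=> y0; rewrite -subr_ge0.
pose f z : R := (2 + z) * ln (1 + z) - 2 * z.
pose f' z : R := ln (1 + z) + (2 + z) / (1 + z) - 2.
apply: (@ge0_of_derive_ge0 f f') => // [z z0|z z0|].
- have := is_derive_ln1D z0 => ?.
  by apply: is_derive_eq; rewrite /f' /GRing.scale/=; ring.
- have := ln1D_ge (lt_le_trans (ltrN10 R) z0); rewrite /f'; set w := z / (1 + z).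
  have -> : (2 + z) / (1 + z) = 2 - w.
    by rewrite /w; field; rewrite gt_eqF// ltr_wpDr.
  lra.
- by rewrite /f !addr0 ln1; ring.
Qed.

Lemma mulr_ln1D_le y : 0 <= y -> 2 * (1 + y) * ln (1 + y) <= y * (y + 2).
Proof.
move=> y0; rewrite -subr_ge0.
pose f z : R := z * (z + 2) - 2 * (1 + z) * ln (1 + z).
pose f' z : R := 2 * (z - ln (1 + z)).
apply: (@ge0_of_derive_ge0 f f') => // [z z0|z z0|].
- have := is_derive_ln1D z0 => ?.
  apply: is_derive_eq; rewrite /f' /GRing.scale/=; field.
  by rewrite gt_eqF// ltr_wpDr.
- by rewrite /f' mulr_ge0// subr_ge0 le_ln1Dx// (lt_le_trans _ z0)// ltrN10.
- by rewrite /f !addr0 ln1; ring.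
Qed.

Definition log_stirling n : R := ln n`!%:R + n%:R - (n%:R + 2^-1) * ln n%:R.

(** The difference is (n + 1/2) ln (1 + 1/n) - 1, and the two bounds are those of
[mulr_ln1D_ge] and [mulr_ln1D_le] at y = 1/n. So [log_stirling] decreases while
log_stirling n - 1/(4n) increases. *)
Lemma log_stirling_step n : (0 < n)%N ->
  0 <= log_stirling n - log_stirling n.+1 <= (4 * n%:R)^-1 - (4 * n.+1%:R)^-1.
Proof.
move=> n0; have n0R : 0 < n%:R :> R by rewrite ltr0n.
have n0' : n%:R != 0 :> R by rewrite gt_eqF.
have n1' : 1 + n%:R != 0 :> R by rewrite gt_eqF// addr_gt0.
have -> : log_stirling n - log_stirling n.+1 =
    (n%:R + 2^-1) * ln (1 + n%:R^-1) - 1.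
  have -> : ln (1 + n%:R^-1) = ln n.+1%:R - ln n%:R :> R.
    rewrite -ln_div ?posrE ?ltr0n//; congr ln.
    by rewrite -natr1; field.
  rewrite /log_stirling factS natrM lnM ?posrE ?ltr0n ?fact_gt0//.
  by rewrite -natr1; field.
have y0 : 0 <= n%:R^-1 :> R by rewrite invr_ge0 ltW.
have h1 := mulr_ln1D_ge y0; have h2 := mulr_ln1D_le y0.
set L := ln _ in h1 h2 *.
apply/andP; split.
  have : n%:R * (2 * n%:R^-1) <= n%:R * ((2 + n%:R^-1) * L).
    by rewrite ler_pM2l.
  rewrite mulrCA divff// mulr1 mulrA mulrDr divff// => h; lra.
have : n%:R * n%:R * (2 * (1 + n%:R^-1) * L) <= n%:R * n%:R * (n%:R^-1 * (n%:R^-1 + 2)).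
  by rewrite ler_pM2l// mulr_gt0.
have -> : n%:R * n%:R * (n%:R^-1 * (n%:R^-1 + 2)) = 1 + 2 * n%:R :> R by field.
have -> : n%:R * n%:R * (2 * (1 + n%:R^-1) * L) = 2 * n%:R * (1 + n%:R) * L :> R.
  by field.
move=> h.
have -> : (4 * n%:R)^-1 - (4 * n.+1%:R)^-1 = (4 * n%:R * (1 + n%:R))^-1 :> R.
  by rewrite -[n.+1%:R]natr1 [n%:R + 1]addrC; field; rewrite n0' n1'.
rewrite -[leRHS]mul1r ler_pdivlMr; last by rewrite !mulr_gt0// addr_gt0.
have : (2 * n%:R + 1) * (2 * n%:R * (1 + n%:R) * L) <= (2 * n%:R + 1) * (1 + 2 * n%:R).
  by rewrite ler_pM2l// addr_gt0// mulr_gt0.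
by move=> h'; nra.
Qed.

Definition stirling n : R := n`!%:R * expR n%:R / (n%:R ^+ n * Num.sqrt n%:R).

Lemma stirlingE n : (0 < n)%N -> stirling n = expR (log_stirling n).
Proof.
move=> n0; have n0R : 0 < n%:R :> R by rewrite ltr0n.
rewrite /stirling /log_stirling expRB expRD lnK ?posrE ?ltr0n ?fact_gt0//.
congr (_ / _); rewrite mulrDl expRD expRM_natl lnK ?posrE//; congr (_ * _).
rewrite -[RHS]ger0_norm ?expR_ge0// -sqrtr_sqr -expRM_natl mulrA divff//.
by rewrite mul1r lnK ?posrE.
Qed.

Lemma stirling_cvg : exists2 sigma : R, 0 < sigma & stirling n @[n --> \oo] --> sigma.
Proof.
pose u n := log_stirling n.+1.
have ustep n := @log_stirling_step n.+1 isT.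
have u_ge n : u 0%N - 4^-1 <= u n - (4 * n.+1%:R)^-1.
  elim: n => [|n IH]; first by rewrite mulr1.
  have /andP[_] := ustep n; rewrite /u in IH *; move: IH.
  move: (4 * n.+1%:R)^-1 (4 * n.+2%:R)^-1 => a b; lra.
have uni : nonincreasing_seq u.
  by apply/nonincreasing_seqP => n; have /andP[+ _] := ustep n; rewrite subr_ge0.
have ucvg : cvgn u.
  apply: nonincreasing_is_cvgn => //.
  exists (u 0%N - 4^-1) => _ [n _ <-].
  by rewrite (le_trans (u_ge n))// gerBl invr_ge0 mulr_ge0.
exists (expR (limn u)); first exact: expR_gt0.
rewrite -(cvg_shiftS stirling).
rewrite (_ : [sequence stirling n.+1]_n = expR \o u); last first.
  by apply/funext => n /=; rewrite stirlingE.
apply: continuous_cvg; first exact: continuous_expR.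
exact: ucvg.
Qed.

End stirling.

(** * Limits of the ballot weights *)

Section passage_asymptotics.
Context {R : realType} {T : Type} {F : set_system T} {FF : ProperFilter F}.

Lemma cvg_invn (n : T -> nat) : n t @[t --> F] --> \oo ->
  ((n t)%:R^-1 : R) @[t --> F] --> (0 : R).
Proof.
move=> noo; apply: (cvg_comp n (fun m => m%:R^-1 : R) noo).
rewrite -(cvg_shiftS (fun m => m%:R^-1 : R)).
exact: cvg_harmonic.
Qed.

Lemma near_ge (n : T -> nat) m : n t @[t --> F] --> \oo -> \forall t \near F, (m <= n t)%N.
Proof. by move=> /cvgnyPge. Qed.

Lemma cvg_expn (f : T -> R) (a : R) n : f t @[t --> F] --> a -> f t ^+ n @[t --> F] --> a ^+ n.
Proof.
by move=> fa; exact: (continuous_cvg _ (@exprn_continuous R n a) fa).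
Qed.

(** Squeeze n ln (1 + s/n) between s / (1 + s/n) and s. *)
Lemma cvg_expr_expR (s : T -> R) (n : T -> nat) (s0 : R) :
  s t @[t --> F] --> s0 -> n t @[t --> F] --> \oo ->
  (1 + s t / (n t)%:R) ^+ n t @[t --> F] --> expR s0.
Proof.
move=> ss noo; have n0 := cvg_invn noo.
have sn0 : s t / (n t)%:R @[t --> F] --> (0 : R).
  by rewrite -(mulr0 s0); exact: cvgM.
have near1 : \forall t \near F, `|s t / (n t)%:R| < 1.
  by have /cvgr0Pnorm_lt := sn0; apply.
apply: (@cvg_trans _ (expR (ln (1 + s t / (n t)%:R) *+ n t) @[t --> F])).
  apply: near_eq_cvg; near=> t.
  have : `|s t / (n t)%:R| < 1 by near: t.
  rewrite ltr_norml => /andP[h _]. 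
  by rewrite -lnXn ?lnK ?posrE ?exprn_gt0//; lra.
apply: continuous_cvg; first exact: continuous_expR.
have sq : \forall t \near F, s t / (1 + s t / (n t)%:R) <=
    ln (1 + s t / (n t)%:R) *+ n t <= s t.
  near=> t.
  have : `|s t / (n t)%:R| < 1 by near: t.
  rewrite ltr_norml => /andP[h _]; set h' := s t / _ in h *.
  have n_gt0 : 0 < (n t)%:R :> R by rewrite ltr0n; near: t; exact: near_ge.
  have sE : s t = h' *+ n t by rewrite -mulr_natr /h' divfK// gt_eqF.
  have h1 : 0 < 1 + h' by lra.
  rewrite sE mulrnAl !lerMn2r.
  by apply/andP; split; apply/orP; right; [exact: ln1D_ge|exact: le_ln1Dx].
apply: (squeeze_cvgr sq) => //.
rewrite -[X in _ --> X]divr1; apply: cvgM => //.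
  rewrite -{1}[X in X^-1](addr0 1); apply: cvgV; rewrite ?addr0 ?oner_eq0//.
  by rewrite -[X in _ --> X](addr0 1); apply: cvgD => //; exact: cvg_cst.
Unshelve. all: by end_near. Qed.


Lemma cvg_ffact (j : T -> nat) c : j t @[t --> F] --> \oo ->
  (j t ^_ c)%:R / (j t)%:R ^+ c @[t --> F] --> (1 : R).
Proof.
move=> joo; elim: c => [|c IH].
  under eq_cvg do rewrite ffactn0 expr0 divr1; exact: cvg_cst.
have near_j : \forall t \near F, (c < j t)%N by exact: near_ge.
have : (j t ^_ c)%:R / (j t)%:R ^+ c * (1 - c%:R * (j t)%:R^-1)
    @[t --> F] --> (1 * (1 - c%:R * 0) : R).
  apply: cvgM => //; apply: cvgB; first exact: cvg_cst.
  by apply: cvgM; [exact: cvg_cst|exact: cvg_invn].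
rewrite mulr0 subr0 mulr1; apply: cvg_trans; apply: near_eq_cvg; near=> t.
have cj : (c < j t)%N by near: t.
have j0 : (j t)%:R != 0 :> R by rewrite pnatr_eq0 -lt0n (leq_ltn_trans _ cj).
rewrite ffactnSr natrM natrB 1?ltnW// exprSr.
by field; rewrite j0 expf_neq0.
Unshelve. all: by end_near. Qed.

(** Ballot weights are compared with n^(n-1)/n!, the coefficients of the tree
function. *)
Definition tree_weight n : R := n%:R ^+ n.-1 / n`!%:R.

Lemma tree_weight_gt0 n : 0 < tree_weight n.
Proof.
by rewrite /tree_weight divr_gt0 ?ltr0n ?fact_gt0//; case: n.
Qed.

Lemma cvg_passage (j : T -> nat) (xt : T -> R) (x0 tau : R) c :
  j t @[t --> F] --> \oo -> xt t @[t --> F] --> x0 ->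
  passage tau (j t) (xt t) c / tree_weight (j t) @[t --> F] -->
  expR (tau - x0) * (tau + c%:R - x0).
Proof.
move=> joo xtx0.
have scvg : tau - xt t @[t --> F] --> tau - x0.
  by apply: cvgB => //; exact: cvg_cst.
have s0 : (tau - xt t) / (j t)%:R @[t --> F] --> (0 : R).
  by rewrite -(mulr0 (tau - x0)); apply: cvgM => //; exact: cvg_invn.
have s1 : 1 + (tau - xt t) / (j t)%:R @[t --> F] --> (1 : R).
  by rewrite -[X in _ --> X]addr0; apply: cvgD => //; exact: cvg_cst.
have near1 : \forall t \near F, 0 < 1 + (tau - xt t) / (j t)%:R.
  exact: (cvgr_gt _ s1 _ ltr01).
have near_j : \forall t \near F, (c < j t)%N by exact: near_ge.
have : (1 + (tau - xt t) / (j t)%:R) ^+ j t *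
    (1 + (tau - xt t) / (j t)%:R) ^- c.+1 *
    ((j t ^_ c)%:R / (j t)%:R ^+ c) * (tau + c%:R - xt t) @[t --> F] -->
    expR (tau - x0) * 1 ^- c.+1 * 1 * (tau + c%:R - x0).
  apply: cvgM; last by apply: cvgB => //; exact: cvg_cst.
  apply: cvgM; last exact: cvg_ffact.
  apply: cvgM; first exact: cvg_expr_expR.
  by apply: cvgV; [rewrite expr1n oner_eq0|exact: cvg_expn].
rewrite expr1n invr1 !mulr1; apply: cvg_trans; apply: near_eq_cvg; near=> t.
have cj : (c < j t)%N by near: t.
have j_gt0 : 0 < (j t)%:R :> R by rewrite ltr0n (leq_ltn_trans _ cj).
have : 0 < 1 + (tau - xt t) / (j t)%:R by near: t.
set s := (tau - xt t) / (j t)%:R => sp.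
rewrite passage_lt// /tree_weight.
have -> : tau + (j t)%:R - xt t = (j t)%:R * (1 + s).
  by rewrite /s; field; rewrite gt_eqF.
have -> : (j t)`!%:R = (j t ^_ c)%:R * (j t - c)`!%:R :> R.
  by rewrite -natrM ffact_fact// ltnW.
have fc : (j t ^_ c)%:R != 0 :> R by rewrite pnatr_eq0 -lt0n ffact_gt0 ltnW.
have e1 : (j t = (j t - c).-1 + c.+1)%N by lia.
have e2 : ((j t).-1 = (j t - c).-1 + c)%N by lia.
rewrite {1}e1 e2 exprMn !exprD.
have h1 : (1 + s) != 0 by rewrite gt_eqF.
have h2 := @fact_neq0R R (j t - c).
have h3 : (j t)%:R != 0 :> R by rewrite gt_eqF.
by field; rewrite fc h2 ?expf_neq0.
Unshelve. all: by end_near. Qed.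

Lemma cvg_sum (I : Type) (r : seq I) (f : I -> T -> R) (a : I -> R) :
  (forall i, f i t @[t --> F] --> a i) ->
  \sum_(i <- r) f i t @[t --> F] --> \sum_(i <- r) a i.
Proof.
move=> fa; elim: r => [|i r IH].
  by under eq_cvg do rewrite big_nil; rewrite big_nil; exact: cvg_cst.
by under eq_cvg do rewrite big_cons; rewrite big_cons; exact: cvgD.
Qed.

Lemma cvg_surv (xt : T -> nat -> R) (x : nat -> R) i c :
  (forall i', (i' <= i)%N -> xt t i' @[t --> F] --> x i') ->
  surv (xt t) i c @[t --> F] --> surv x i c.
Proof.
elim: i c => [|i IH] c xtx /=; first exact: cvg_cst.
case: ifP => _; last exact: cvg_cst.
apply: cvg_sum => d; apply: cvgM; first by apply: IH => i' i'i; exact/xtx/leqW.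
rewrite /kern; case: ifP => _; last exact: cvg_cst.
rewrite /dpow; apply: cvgM; last exact: cvg_cst.
by apply: cvg_expn; apply: cvgB; exact: xtx.
Qed.

(** Optional stopping for tau + c - x m, where c is the count of a unit rate
Poisson process at level x m: this is the expectation of tau + c - x m on the
survival of the first m constraints. *)
Definition mean_excess (x : nat -> R) m tau : R :=
  tau - \sum_(i < m) surv x i i * expR (- x i.+1) * (tau + i%:R - x i.+1).

Lemma cvg_surv_passage (j : T -> nat) (xt : T -> nat -> R) (x : nat -> R) m tau :
  j t @[t --> F] --> \oo ->
  (forall i, (i <= m)%N -> xt t i @[t --> F] --> x i) ->
  surv_passage (xt t) m tau (j t) / tree_weight (j t) @[t --> F] -->
  expR tau * mean_excess x m tau.
Proof.
move=> joo xtx; rewrite /surv_passage.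
under eq_cvg do rewrite mulrBl mulr_suml.
rewrite /mean_excess mulrBr mulr_sumr; apply: cvgB.
  rewrite -{3}[tau](addr0) -[X in _ * X]subr0 -{2}[tau](subr0).
  by apply: (@cvg_passage j (fun=> 0) 0 tau 0) => //; exact: cvg_cst.
apply: cvg_sum => i.
have -> : expR tau * (surv x i i * expR (- x i.+1) * (tau + i%:R - x i.+1)) =
    surv x i i * (expR (tau - x i.+1) * (tau + i%:R - x i.+1)).
  by rewrite expRD; ring.
under eq_cvg do rewrite -mulrA.
apply: cvgM; last by apply: cvg_passage => //; exact: xtx.
apply: cvg_surv => i' i'i; apply: xtx.
exact: leq_trans i'i (ltnW (ltn_ord i)).
Qed.

End passage_asymptotics.

(** * The telescoping profile *)

Section profile.
Context {R : realType}.

(** The inverse of the normalisation sqrt (jN / (N - j)). *)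
Definition profile N j : R := Num.sqrt (j%:R^-1 - N%:R^-1).

Lemma profile_ge0 N j : 0 <= profile N j.
Proof. exact: sqrtr_ge0. Qed.

Lemma profile_gt0 N j : (0 < j < N)%N -> 0 < profile N j.
Proof.
move=> /andP[j0 jN]; rewrite sqrtr_gt0 subr_gt0 ltf_pV2 ?posrE ?ltr_nat ?ltr0n//.
exact: leq_trans jN.
Qed.

Lemma profileE j p : (0 < j)%N ->
  profile (j + p) j = Num.sqrt p%:R / (Num.sqrt j%:R * Num.sqrt (j + p)%:R).
Proof.
move=> j0; rewrite /profile -sqrtrM// -sqrtrV// -sqrtrM//; congr Num.sqrt.
have h : j%:R != 0 :> R by rewrite pnatr_eq0 -lt0n.
have h' : j%:R + p%:R != 0 :> R by rewrite -natrD pnatr_eq0 -lt0n ltn_addr.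
by rewrite natrD; field; rewrite h h'.
Qed.

Lemma profile_gap N j : (0 < j < N)%N ->
  (profile N j - profile N j.+1) * (profile N j + profile N j.+1) =
  (j%:R * j.+1%:R)^-1.
Proof.
move=> /andP[j0 jN]; rewrite -subr_sqr !sqr_sqrtr ?subr_ge0.
- have h : j%:R != 0 :> R by rewrite pnatr_eq0 -lt0n.
  have h' : 1 + j%:R != 0 :> R by rewrite nat1r pnatr_eq0.
  have h'' : N%:R != 0 :> R by rewrite pnatr_eq0 -lt0n (leq_trans _ jN).
  by rewrite -nat1r; field; rewrite h h' h''.
- by rewrite lef_pV2 ?posrE ?ler_nat ?ltr0n// (leq_trans _ jN).
- by rewrite lef_pV2 ?posrE ?ler_nat ?ltr0n ?(ltnW jN)// (leq_trans _ jN).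
Qed.

Lemma profile_ratio j p : (0 < j)%N -> (0 < p)%N ->
  profile (j + p) j.+1 / profile (j + p) j =
  Num.sqrt ((1 - p%:R^-1) * (1 + j%:R^-1)^-1).
Proof.
move=> j0 p0.
have jR : 0 < j%:R :> R by rewrite ltr0n.
have pR : 0 < p%:R :> R by rewrite ltr0n.
rewrite /profile -sqrtrV; last first.
  by rewrite subr_ge0 lef_pV2 ?posrE ?ler_nat ?ltr0n ?leq_addr// ltn_addr.
rewrite -sqrtrM; last first.
  rewrite subr_ge0 lef_pV2 ?posrE ?ler_nat ?ltr0n//; lia.
congr Num.sqrt; rewrite natrD -[j.+1%:R]nat1r.
have h1 : 1 + j%:R != 0 :> R by rewrite gt_eqF// addr_gt0.
have h2 : j%:R + p%:R != 0 :> R by rewrite gt_eqF// addr_gt0.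
by field; rewrite !gt_eqF ?addr_gt0.
Qed.

(** The summand for N = j + p with the boundary data stripped off. *)
Definition edge_weight p j : R :=
  (j + p)`!%:R / (j + p)%:R ^+ (j + p) * (p%:R ^+ p / p`!%:R) * tree_weight j.

(** Stirling's formula for the three factorials; all exponentials and n-th powers
cancel as N = j + p. *)
Lemma edge_weightE p j : (0 < j)%N -> (0 < p)%N ->
  edge_weight p j = stirling (j + p) / (stirling p * stirling j) /
    (j%:R ^+ 2 * profile (j + p) j).
Proof.
move=> j0 p0; rewrite profileE// /edge_weight /tree_weight /stirling.
rewrite [X in expR X]natrD expRD.
have jR : 0 < j%:R :> R by rewrite ltr0n.
have pR : 0 < p%:R :> R by rewrite ltr0n.
have NR : 0 < (j + p)%:R :> R by rewrite ltr0n addn_gt0 j0.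
have e1 : expR p%:R != 0 :> R by rewrite gt_eqF// expR_gt0.
have e2 : expR j%:R != 0 :> R by rewrite gt_eqF// expR_gt0.
have s1 : Num.sqrt j%:R != 0 :> R by rewrite gt_eqF// sqrtr_gt0.
have s2 : Num.sqrt p%:R != 0 :> R by rewrite gt_eqF// sqrtr_gt0.
have s3 : Num.sqrt (j + p)%:R != 0 :> R by rewrite gt_eqF// sqrtr_gt0.
have x1 : (j + p)%:R ^+ (j + p) != 0 :> R by rewrite gt_eqF// exprn_gt0.
have x2 : p%:R ^+ p != 0 :> R by rewrite gt_eqF// exprn_gt0.
have x3 : j%:R ^+ j.-1 != 0 :> R by rewrite gt_eqF// exprn_gt0.
have f1 := @fact_neq0R R j; have f2 := @fact_neq0R R p.
have f3 := @fact_neq0R R (j + p).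
have -> : j%:R ^+ j = j%:R * j%:R ^+ j.-1 :> R by rewrite -exprS prednK.
have j1 : j%:R != 0 :> R by rewrite gt_eqF.
have ss : Num.sqrt p%:R * Num.sqrt p%:R = p%:R :> R by rewrite -expr2 sqr_sqrtr// ltW.
have ss' : Num.sqrt j%:R * Num.sqrt j%:R = j%:R :> R by rewrite -expr2 sqr_sqrtr// ltW.
move: (Num.sqrt p%:R) s2 ss => sp s2 ss.
move: (Num.sqrt j%:R) s1 ss' => sj s1 ss'.
move: (j%:R ^+ j.-1) x3 => xj x3.
rewrite -ss'.
field.
by rewrite ss' s3 s1 s2 x3 x2 e2 f1 e1 f2 x1.
Qed.

Lemma edge_weight_gap p j : (0 < j)%N -> (0 < p)%N ->
  edge_weight p j / (profile (j + p) j - profile (j + p) j.+1) =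
  stirling (j + p) / (stirling p * stirling j) * (1 + j%:R^-1) *
  (1 + Num.sqrt ((1 - p%:R^-1) * (1 + j%:R^-1)^-1)).
Proof.
move=> j0 p0; rewrite -profile_ratio// edge_weightE//.
have jN : (0 < j < j + p)%N by lia.
have := @profile_gap _ _ jN; have f1 := profile_gt0 jN.
have := profile_ge0 (j + p) j.+1.
set f := profile (j + p) j in f1 *; set g := profile (j + p) j.+1 => g0 gapE.
have jR : 0 < j%:R :> R by rewrite ltr0n.
have jR' : 0 < 1 + j%:R :> R by rewrite addr_gt0.
have fg : f + g != 0 by rewrite gt_eqF// ltr_wpDr.
have -> : f - g = (j%:R * (1 + j%:R))^-1 / (f + g) by rewrite nat1r -gapE mulfK.
by move: (stirling _ / _) => S; field; rewrite fg !gt_eqF.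
Qed.

(** The increment of [profile] is 1/(j (j+1)) over a sum of two nearly equal
values, hence the factor 2. *)
Lemma cvg_edge_weight {T : Type} {F : set_system T} {FF : ProperFilter F}
    (j p : T -> nat) (sigma : R) : 0 < sigma ->
  (@stirling R) n @[n --> \oo] --> sigma ->
  j t @[t --> F] --> \oo -> p t @[t --> F] --> \oo ->
  edge_weight (p t) (j t) /
    (profile (j t + p t) (j t) - profile (j t + p t) (j t).+1) @[t --> F] -->
  2 / sigma.
Proof.
move=> sigma0 st joo poo.
have Noo : (j t + p t)%N @[t --> F] --> \oo.
  apply/cvgnyPge => A; apply: filterS (near_ge A joo) => t At.
  by rewrite (leq_trans At)// leq_addr.
have j0 := cvg_invn (R := R) joo; have p0 := cvg_invn (R := R) poo.
have stc (n : T -> nat) : n t @[t --> F] --> \oo ->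
    (@stirling R) (n t) @[t --> F] --> sigma.
  by move=> noo; exact: (cvg_comp n (@stirling R) noo st).
have j1 : 1 + ((j t)%:R^-1 : R) @[t --> F] --> (1 : R).
  by rewrite -[X in _ --> X]addr0; apply: cvgD => //; exact: cvg_cst.
have p1 : 1 - ((p t)%:R^-1 : R) @[t --> F] --> (1 : R).
  by rewrite -[X in _ --> X]subr0; apply: cvgB => //; exact: cvg_cst.
have jpos : \forall t \near F, (0 < j t)%N by exact: near_ge.
have ppos : \forall t \near F, (0 < p t)%N by exact: near_ge.
have : stirling (j t + p t) / (stirling (p t) * stirling (j t)) *
    (1 + (j t)%:R^-1) *
    (1 + Num.sqrt ((1 - (p t)%:R^-1) * (1 + (j t)%:R^-1)^-1)) @[t --> F] -->
    sigma / (sigma * sigma) * 1 * (1 + Num.sqrt (1 * 1^-1)).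
  apply: cvgM; first (apply: cvgM => //; apply: cvgM; first exact: stc).
    by apply: cvgV; [rewrite mulf_neq0// gt_eqF|apply: cvgM; exact: stc].
  apply: cvgD; first exact: cvg_cst.
  apply: continuous_cvg; first exact: sqrt_continuous.
  by apply: cvgM => //; apply: cvgV => //; exact: oner_neq0.
have -> : sigma / (sigma * sigma) * 1 * (1 + Num.sqrt (1 * 1^-1)) = 2 / sigma.
  by rewrite invr1 !mulr1 sqrtr1; field; rewrite gt_eqF.
apply: cvg_trans; apply: near_eq_cvg; near=> t.
by rewrite edge_weight_gap//; near: t.
Unshelve. all: by end_near. Qed.

End profile.

(** * Two-sided asymptotics of the survival probability *)

Section survival_asymptotics.
Context {R : realType}.
Implicit Types (tau : R) (x : nat -> R).

(** Weight of the N - j lines that remain above the affine boundary once the path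
has crossed it at count j. It may be negative when N - j < tau. *)
Definition above_weight tau N j : R :=
  N`!%:R / N%:R ^+ N * dpow (N - j) (N%:R - tau - j%:R).

Lemma above_weightE tau p j : (0 < p)%N ->
  above_weight tau (j + p) j =
  edge_weight p j / tree_weight j * (1 + (- tau) / p%:R) ^+ p.
Proof.
move=> p0; rewrite /above_weight /edge_weight /dpow addKn natrD.
have p1 : p%:R != 0 :> R by rewrite pnatr_eq0 -lt0n.
have -> : j%:R + p%:R - tau - j%:R = p%:R * (1 + (- tau) / p%:R) by field.
rewrite -natrD exprMn mulfK ?gt_eqF ?tree_weight_gt0//.
have f2 := @fact_neq0R R p.
have N1 : (j + p)%:R ^+ (j + p) != 0 :> R.
  by rewrite expf_neq0// pnatr_eq0 -lt0n addn_gt0 p0 orbT.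
by field; apply/andP.
Qed.

Lemma cvg_above_weight_passage {T : Type} {F : set_system T} {FF : ProperFilter F}
    (j p : T -> nat) (sigma : R) (xN : nat -> nat -> R) x m tau : 0 < sigma ->
  (@stirling R) n @[n --> \oo] --> sigma ->
  j t @[t --> F] --> \oo -> p t @[t --> F] --> \oo ->
  (forall i, (i <= m)%N -> xN N i @[N --> \oo] --> x i) ->
  above_weight tau (j t + p t) (j t) * surv_passage (xN (j t + p t)%N) m tau (j t) /
    (profile (j t + p t) (j t) - profile (j t + p t) (j t).+1) @[t --> F] -->
  2 / sigma * mean_excess x m tau.
Proof.
move=> sigma0 st joo poo xx.
have Noo : (j t + p t)%N @[t --> F] --> \oo.
  apply/cvgnyPge => A; apply: filterS (near_ge A joo) => t At.
  by rewrite (leq_trans At)// leq_addr.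
have ppos : \forall t \near F, (0 < p t)%N by exact: near_ge.
have : edge_weight (p t) (j t) /
    (profile (j t + p t) (j t) - profile (j t + p t) (j t).+1) *
    (1 + (- tau) / (p t)%:R) ^+ p t *
    (surv_passage (xN (j t + p t)%N) m tau (j t) / tree_weight (j t)) @[t --> F] -->
    2 / sigma * expR (- tau) * (expR tau * mean_excess x m tau).
  apply: cvgM; last first.
    apply: (@cvg_surv_passage R T F FF j (fun t => xN (j t + p t)%N) x m tau joo) => i im.
    exact: (cvg_comp (fun t => (j t + p t)%N) (fun N => xN N i) Noo (xx _ im)).
  apply: cvgM; first exact: cvg_edge_weight.
  by apply: cvg_expr_expR => //; exact: cvg_cst.
have -> : 2 / sigma * expR (- tau) * (expR tau * mean_excess x m tau) =
    2 / sigma * mean_excess x m tau.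
  rewrite mulrA -[_ * _ * expR tau]mulrA -expRD addNr expR0 mulr1//.
apply: cvg_trans; apply: near_eq_cvg; near=> t.
rewrite above_weightE; last by near: t.
by move: (edge_weight _ _) (surv_passage _ _ _ _) (_ ^+ p t) => a b c; ring.
Unshelve. all: by end_near. Qed.

Lemma near_prod_nat (Q : nat * nat -> Prop) :
  (\forall z \near filter_prod \oo \oo, Q z) ->
  exists J, forall i j, (J <= i)%N -> (J <= j)%N -> Q (i, j).
Proof.
move=> [[A B] /= [[a _ aA] [b _ bB]] AB]; exists (maxn a b) => i j.
rewrite !geq_max => /andP[ai bi] /andP[aj bj].
by apply: AB; split; [exact: aA|exact: bB].
Qed.

(** Both j and N - j (or N) tend to infinity, independently of each other. *)
Definition diagonal : set_system (nat * nat) := filter_prod \oo \oo.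
#[local] Instance diagonal_filter : ProperFilter diagonal.
Proof. exact: filter_prod_proper. Qed.

Lemma surv_passage_bounded (xN : nat -> nat -> R) x m tau :
  (forall i, (i <= m)%N -> xN N i @[N --> \oo] --> x i) ->
  exists J (B : R), 0 <= B /\ forall N j, (J <= N)%N -> (J <= j)%N ->
    surv_passage (xN N) m tau j <= B * tree_weight j.
Proof.
move=> xx.
have c1 : fst z @[z --> diagonal] --> \oo by exact: cvg_fst.
have c2 : snd z @[z --> diagonal] --> \oo by exact: cvg_snd.
have /cvgrPdist_le /(_ 1 ltr01) := @cvg_surv_passage R _ _ diagonal_filter snd
  (fun z => xN z.1) x m tau c2
  (fun i im => cvg_comp (fst : nat * nat -> nat) (fun N => xN N i) c1 (xx i im)).
move=> /near_prod_nat[J hJ].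
exists J, (`|expR tau * mean_excess x m tau| + 1); split; first by rewrite addr_ge0.
move=> N j JN Jj; rewrite -ler_pdivrMr ?tree_weight_gt0//.
have := hJ _ _ JN Jj; rewrite /= ler_distlC => /andP[_ h].
by rewrite (le_trans h)// lerD2r ler_norm.
Qed.

Lemma above_weight_passage_near (sigma : R) (xN : nat -> nat -> R) x m tau (eta : R) :
  0 < sigma -> (@stirling R) n @[n --> \oo] --> sigma ->
  (forall i, (i <= m)%N -> xN N i @[N --> \oo] --> x i) -> 0 < eta ->
  exists J, forall N j, (J <= j)%N -> (J <= N - j)%N ->
  `|above_weight tau N j * surv_passage (xN N) m tau j -
    2 / sigma * mean_excess x m tau * (profile N j - profile N j.+1)| <=
  eta * (profile N j - profile N j.+1).
Proof.
move=> sigma0 st xx eta0.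
have c1 : fst z @[z --> diagonal] --> \oo by exact: cvg_fst.
have c2 : snd z @[z --> diagonal] --> \oo by exact: cvg_snd.
have /cvgrPdist_le /(_ eta eta0) := @cvg_above_weight_passage _ _
  diagonal_filter fst snd sigma xN x m tau sigma0 st c1 c2 xx.
move=> /near_prod_nat[J hJ]; exists J.+1 => N j Jj Jp.
have jN : (j < N)%N by lia.
have := hJ j (N - j)%N (ltnW Jj) (ltnW Jp); rewrite /= subnKC; last exact: ltnW.
have j0 : (0 < j < N)%N by rewrite jN andbT (leq_trans _ Jj).
have gap0 : 0 < profile N j - profile N j.+1 :> R.
  have := @profile_gap R _ _ j0.
  have sp : 0 < profile N j + profile N j.+1 :> R.
    by rewrite ltr_wpDr ?profile_ge0// profile_gt0.
  rewrite -(pmulr_lgt0 _ sp) => ->.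
  by rewrite invr_gt0 mulr_gt0 ?ltr0n//; case/andP: j0.
move=> h; rewrite -(ler_pM2r gap0) in h.
apply: le_trans h; rewrite -{3}(gtr0_norm gap0) -normrM mulrBl divfK ?gt_eqF//.
by rewrite distrC.
Qed.

(** Summing [above_weight_passage_near] over j telescopes the increments of
[profile]. *)
Lemma main_sum (sigma : R) (xN : nat -> nat -> R) x m tau (eta : R) :
  0 < sigma -> (@stirling R) n @[n --> \oo] --> sigma ->
  (forall i, (i <= m)%N -> xN N i @[N --> \oo] --> x i) -> 0 < eta ->
  exists J0, forall J N k, (J0 <= J)%N -> (J <= k)%N -> (J <= N - k)%N ->
  `|\sum_(k <= j < (N - J).+1) above_weight tau N j * surv_passage (xN N) m tau j -
    2 / sigma * mean_excess x m tau * (profile N k - profile N (N - J).+1)| <=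
  eta * profile N k.
Proof.
move=> sigma0 st xx eta0.
have [J0 hJ0] := above_weight_passage_near tau sigma0 st xx eta0.
exists J0.+1 => J N k J0J Jk JN.
have kM : (k <= (N - J).+1)%N by lia.
have tel : \sum_(k <= j < (N - J).+1) (profile N j - profile N j.+1) =
    profile N k - profile N (N - J).+1 :> R.
  rewrite -[LHS]opprK -sumrN; under eq_bigr do rewrite opprB.
  by rewrite telescope_sumr// opprB.
rewrite -tel mulr_sumr -sumrB (le_trans (ler_norm_sum _ _ _))//.
apply: (@le_trans _ _ (\sum_(k <= j < (N - J).+1) eta * (profile N j - profile N j.+1))).
  rewrite !big_nat; apply: ler_sum => j /andP[kj jM]; apply: hJ0; lia.
by rewrite -mulr_sumr tel ler_pM2l// gerBl profile_ge0.
Qed.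

Lemma profile_end N k J : (0 < k)%N -> (k <= N - J)%N -> (k < N)%N ->
  profile N (N - J).+1 <=
  Num.sqrt J%:R * Num.sqrt (N - k)%:R^-1 * profile N k :> R.
Proof.
move=> k0 kJ kN; rewrite /profile -!sqrtrM ?mulr_ge0 ?invr_ge0//.
rewrite ler_wsqrtr//.
have kR : 0 < k%:R :> R by rewrite ltr0n.
have NR : 0 < N%:R :> R by rewrite ltr0n (leq_trans _ kN).
have NkR : 0 < (N - k)%:R :> R by rewrite ltr0n subn_gt0.
have -> : k%:R^-1 - N%:R^-1 = (N - k)%:R / (k%:R * N%:R) :> R.
  by rewrite natrB 1?ltnW//; field; rewrite !gt_eqF.
have -> : J%:R / (N - k)%:R * ((N - k)%:R / (k%:R * N%:R)) = J%:R / (k%:R * N%:R) :> R.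
  by field; rewrite !gt_eqF.
have [MN|NM] := leqP (N - J).+1 N; last first.
  rewrite (@le_trans _ _ 0) ?divr_ge0//.
  by rewrite subr_le0 lef_pV2 ?posrE ?ltr0n ?ler_nat// 1?ltnW// (leq_trans _ kN).
have MR : 0 < (N - J).+1%:R :> R by rewrite ltr0n.
have -> : (N - J).+1%:R^-1 - N%:R^-1 = (N - (N - J).+1)%:R / ((N - J).+1%:R * N%:R) :> R.
  by rewrite natrB//; field; rewrite !gt_eqF.
rewrite ler_pM ?invr_ge0 ?mulr_ge0 ?ler_nat//; first lia.
by rewrite lef_pV2 ?posrE ?mulr_gt0// ler_pM2r// ler_nat leqW.
Qed.

Lemma invn_le_profile N k : (0 < k < N)%N ->
  N%:R^-1 <= Num.sqrt (N - k)%:R^-1 * profile N k :> R.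
Proof.
move=> /andP[k0 kN].
have kR : 0 < k%:R :> R by rewrite ltr0n.
have NR : 0 < N%:R :> R by rewrite ltr0n (leq_trans _ kN).
have NkR : 0 < (N - k)%:R :> R by rewrite ltr0n subn_gt0.
rewrite /profile -sqrtrM ?invr_ge0//.
have -> : k%:R^-1 - N%:R^-1 = (N - k)%:R / (k%:R * N%:R) :> R.
  by rewrite natrB 1?ltnW//; field; rewrite !gt_eqF.
rewrite mulrA mulVf ?mul1r ?gt_eqF//.
rewrite -[leLHS]ger0_norm ?invr_ge0// -sqrtr_sqr ler_wsqrtr//.
rewrite expr2 -invfM lef_pV2 ?posrE ?mulr_gt0//.
by rewrite ler_pM2r// ler_nat ltnW.
Qed.

Lemma tree_weight_fact N q : (q < N)%N ->
  N`!%:R / N%:R ^+ N * tree_weight (N - q) <= N%:R^-1 :> R.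
Proof.
move=> qN; have NR : 0 < N%:R :> R by rewrite ltr0n (leq_trans _ qN).
rewrite /tree_weight -(ffact_fact (ltnW qN)) natrM.
have -> : N%:R ^+ N = N%:R * (N%:R ^+ q * N%:R ^+ (N - q).-1) :> R.
  by rewrite -exprD -exprS; congr (_ ^+ _); lia.
have f1 := @fact_neq0R R (N - q).
have h (n : nat) : N%:R ^+ n != 0 :> R by rewrite expf_neq0// gt_eqF.
have N1 : N%:R != 0 :> R by rewrite gt_eqF.
have -> : (N ^_ q)%:R * (N - q)`!%:R / (N%:R * (N%:R ^+ q * N%:R ^+ (N - q).-1)) *
    ((N - q)%:R ^+ (N - q).-1 / (N - q)`!%:R) =
    N%:R^-1 * (((N ^_ q)%:R / N%:R ^+ q) *
               ((N - q)%:R ^+ (N - q).-1 / N%:R ^+ (N - q).-1)) :> R.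
  by field; rewrite N1 f1 !h.
rewrite ger_pMr ?invr_gt0// mulr_ile1 ?divr_ge0 ?exprn_ge0//.
  rewrite ler_pdivrMr ?exprn_gt0// mul1r -natrX ler_nat.
  by elim: q {qN f1} => // q IH; rewrite ffactnSr expnSr leq_mul// leq_subr.
rewrite ler_pdivrMr ?exprn_gt0// mul1r lerXn2r ?nnegrE//.
by rewrite ler_nat leq_subr.
Qed.

(** The last J summands, for which N - j stays bounded, escape the asymptotics
and may have any sign, but each of them is of order 1/N. *)
Lemma end_sum tau N J : (J < N)%N ->
  \sum_((N - J).+1 <= j < N.+1) `|above_weight tau N j| * tree_weight j <=
  (J%:R * \sum_(q < J) `|dpow q (q%:R - tau)|) * N%:R^-1 :> R.
Proof.
move=> JN; set S := \sum_(q < J) _.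
apply: (@le_trans _ _ (\sum_((N - J).+1 <= j < N.+1) S * N%:R^-1)); last first.
  by rewrite sumr_const_nat subSS subKn 1?ltnW// -[leLHS]mulr_natl mulrA.
rewrite !big_nat; apply: ler_sum => j /andP[Mj jN].
rewrite ltnS in jN.
have qJ : (N - j < J)%N by lia.
have jE : j = (N - (N - j))%N by rewrite subKn.
have -> : above_weight tau N j = N`!%:R / N%:R ^+ N * dpow (N - j) ((N - j)%:R - tau).
  by rewrite /above_weight natrB//; congr (_ * dpow _ _); ring.
rewrite normrM ger0_norm ?divr_ge0 ?exprn_ge0// mulrAC mulrC ler_pM//.
- by rewrite mulr_ge0 ?divr_ge0 ?exprn_ge0// ltW// tree_weight_gt0.
- rewrite /S (bigD1 (Ordinal qJ))//= lerDl sumr_ge0//.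
- by rewrite [in tree_weight j]jE tree_weight_fact// (ltn_trans qJ).
Qed.

Definition survival x N k : R :=
  N`!%:R / N%:R ^+ N * \sum_(c < N.+1) surv x k c * kern (N%:R - x k) c N.

Lemma survivalE x N k tau : x 0%N = 0 -> (k <= N)%N ->
  survival x N k = \sum_(k <= j < N.+1) above_weight tau N j * surv_passage x k tau j.
Proof.
move=> x0 kN; rewrite /survival (survival_expansion tau x0 kN) mulr_sumr.
by apply: eq_bigr => j _; rewrite /above_weight mulrA.
Qed.

Lemma above_weight_ge0 tau N j (J : nat) : tau <= J%:R -> (J <= N - j)%N -> (j <= N)%N ->
  0 <= above_weight tau N j.
Proof.
move=> tauJ JNj jN; rewrite /above_weight; apply: mulr_ge0.
  by rewrite divr_ge0// exprn_ge0.
by rewrite dpow_ge0// addrAC -natrB// subr_ge0 (le_trans tauJ)// ler_nat.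
Qed.

(** Up to j = N - J the coefficients are nonnegative and level k is replaced by
level m using [surv_passage_le]; the other summands are bounded by [end_sum].
The term with C goes to 0 as N - k tends to infinity. *)
Lemma survival_upper (sigma : R) (xN : nat -> nat -> R) x m tau (eta : R) :
  0 < sigma -> (@stirling R) n @[n --> \oo] --> sigma ->
  (forall i, (i <= m)%N -> xN N i @[N --> \oo] --> x i) -> 0 < eta ->
  exists J (C : R), forall N k, (J <= k)%N -> (J <= N - k)%N ->
    xN N 0%N = 0 -> (forall i, (i < k)%N -> xN N i <= xN N i.+1) ->
    (forall i, (m <= i < k)%N -> xN N i.+1 <= tau + i%:R) ->
    survival (xN N) N k <=
    (2 / sigma * mean_excess x m tau + eta + C * Num.sqrt (N - k)%:R^-1) * profile N k.
Proof.
move=> sigma0 st xx eta0.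
have [J1 hJ1] := main_sum tau sigma0 st xx eta0.
have [J2 [B [B0 hB]]] := surv_passage_bounded tau xx.
(* The coefficients are nonnegative as soon as N - j >= J3. *)
have [J3 hJ3] : exists J3 : nat, tau <= J3%:R.
  exists (Num.bound `|tau|); rewrite (le_trans (ler_norm _))// ltW//.
  by rewrite archi_boundP.
pose J := (maxn J1 (maxn J2 (maxn J3 m.+1))).
have [J1J J2J J3J mJ] : [/\ J1 <= J, J2 <= J, J3 <= J & m < J]%N.
  by rewrite /J; split; lia.
set D := 2 / sigma * mean_excess x m tau in hJ1 *.
pose S := J%:R * \sum_(q < J) `|dpow q (q%:R - tau)|.
exists J, (`|D| * Num.sqrt J%:R + B * S) => N k Jk JN x0 xle xtau.
have k0 : (0 < k)%N by lia.
have kN : (k < N)%N by lia.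
have kM : (k <= (N - J).+1)%N by lia.
have MN : ((N - J).+1 <= N.+1)%N by lia.
have xk : xN N k <= tau + k%:R.
  have := xtau k.-1; rewrite prednK// => /(_ ltac:(lia)) h.
  by rewrite (le_trans h)// lerD2l ler_nat leq_pred.
rewrite (survivalE tau x0 (ltnW kN)) (big_cat_nat (n := (N - J).+1))//=.
have main : \sum_(k <= j < (N - J).+1) above_weight tau N j * surv_passage (xN N) k tau j <=
   D * (profile N k - profile N (N - J).+1) + eta * profile N k.
  have := hJ1 J N k J1J Jk JN; rewrite ler_distl => /andP[_].
  apply: le_trans; rewrite !big_nat; apply: ler_sum => j /andP[kj jM].
  apply: ler_wpM2l; first by apply: (@above_weight_ge0 _ _ _ J3) => //; lia.
  by apply: surv_passage_le => //; lia.
have last : \sum_((N - J).+1 <= j < N.+1) above_weight tau N j * surv_passage (xN N) k tau j <=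
    B * S * N%:R^-1.
  apply: (@le_trans _ _ (B *
    \sum_((N - J).+1 <= j < N.+1) `|above_weight tau N j| * tree_weight j)).
    rewrite mulr_sumr !big_nat; apply: ler_sum => j /andP[Mj jN].
    have /andP[h0 _] := @surv_passage_ge0_homo _ (xN N) k tau tau j x0 xle xk (lexx _)
      ltac:(lia).
    rewrite mulrCA (le_trans (ler_wpM2r h0 (ler_norm _)))// ler_wpM2l//.
    by rewrite (le_trans _ (hB N j _ _))//; [apply: surv_passage_le => //; lia|lia|lia].
  by rewrite -mulrA ler_wpM2l// end_sum//; lia.
have e1 := @profile_end N k J k0 ltac:(lia) kN.
have e2 := @invn_le_profile N k ltac:(lia).
have S0 : 0 <= B * S by rewrite !mulr_ge0// sumr_ge0.
have d1 : - (D * profile N (N - J).+1) <=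
    `|D| * (Num.sqrt J%:R * Num.sqrt (N - k)%:R^-1 * profile N k).
  rewrite (le_trans (ler_norm _))// normrN normrM (ger0_norm (profile_ge0 _ _)).
  by rewrite ler_wpM2l.
have d2 := ler_wpM2l S0 e2.
rewrite (le_trans (lerD main last))//.
move: d1 d2; set e := Num.sqrt (N - k)%:R^-1; set f := profile N k.
set g := profile N (N - J).+1; set r := N%:R^-1.
move=> d1 d2; rewrite !mulrDl mulrBr; move: d1 d2; rewrite !mulrA; lra.
Qed.

(** As in [survival_upper]. The second intercept tau' serves only to bound the
last summands: for tau itself, replacing k by m goes in the wrong direction. *)
Lemma survival_lower (sigma : R) (xN : nat -> nat -> R) x m tau tau' (eta : R) :
  0 < sigma -> (@stirling R) n @[n --> \oo] --> sigma ->
  (forall i, (i <= m)%N -> xN N i @[N --> \oo] --> x i) -> 0 < eta ->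
  tau <= tau' ->
  exists J (C : R), forall N k, (J <= k)%N -> (J <= N - k)%N ->
    xN N 0%N = 0 -> (forall i, (i < k)%N -> xN N i <= xN N i.+1) ->
    (forall i, (m <= i < k)%N -> tau + i%:R <= xN N i.+1 <= tau + i.+1%:R) ->
    (forall i, (m <= i < k)%N -> xN N i.+1 <= tau' + i%:R) ->
    (2 / sigma * mean_excess x m tau - eta - C * Num.sqrt (N - k)%:R^-1) * profile N k
    <= survival (xN N) N k.
Proof.
move=> sigma0 st xx eta0 tt.
have [J1 hJ1] := main_sum tau sigma0 st xx eta0.
have [J2 [B [B0 hB]]] := surv_passage_bounded tau' xx.
(* The coefficients are nonnegative as soon as N - j >= J3. *)
have [J3 hJ3] : exists J3 : nat, tau <= J3%:R.
  exists (Num.bound `|tau|); rewrite (le_trans (ler_norm _))// ltW//.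
  by rewrite archi_boundP.
pose J := (maxn J1 (maxn J2 (maxn J3 m.+1))).
have [J1J J2J J3J mJ] : [/\ J1 <= J, J2 <= J, J3 <= J & m < J]%N.
  by rewrite /J; split; lia.
set D := 2 / sigma * mean_excess x m tau in hJ1 *.
pose S := J%:R * \sum_(q < J) `|dpow q (q%:R - tau)|.
exists J, (`|D| * Num.sqrt J%:R + B * S) => N k Jk JN x0 xle xtau xtau'.
have k0 : (0 < k)%N by lia.
have kN : (k < N)%N by lia.
have kM : (k <= (N - J).+1)%N by lia.
have MN : ((N - J).+1 <= N.+1)%N by lia.
have xk : xN N k <= tau + k%:R.
  by have := xtau k.-1; rewrite prednK// => /(_ ltac:(lia)) /andP[].
rewrite (survivalE tau x0 (ltnW kN)) (big_cat_nat (n := (N - J).+1))//=.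
have main : D * (profile N k - profile N (N - J).+1) - eta * profile N k <=
    \sum_(k <= j < (N - J).+1) above_weight tau N j * surv_passage (xN N) k tau j.
  have := hJ1 J N k J1J Jk JN; rewrite ler_distl => /andP[+ _].
  move=> /le_trans; apply; rewrite !big_nat; apply: ler_sum => j /andP[kj jM].
  apply: ler_wpM2l; first by apply: (@above_weight_ge0 _ _ _ J3) => //; lia.
  by apply: surv_passage_ge => //; lia.
have last : - (B * S * N%:R^-1) <=
    \sum_((N - J).+1 <= j < N.+1) above_weight tau N j * surv_passage (xN N) k tau j.
  apply: (@le_trans _ _ (- (B *
    \sum_((N - J).+1 <= j < N.+1) `|above_weight tau N j| * tree_weight j))).
    by rewrite lerN2 -mulrA ler_wpM2l// end_sum//; lia.
  rewrite mulr_sumr -sumrN !big_nat; apply: ler_sum => j /andP[Mj jN].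
  have /andP[h0 h1] := @surv_passage_ge0_homo _ (xN N) k tau tau' j x0 xle xk tt ltac:(lia).
  rewrite lerNl -mulNr (le_trans (ler_wpM2r h0 (ler_norm _)))// normrN mulrCA.
  rewrite ler_wpM2l// (le_trans h1)// (le_trans _ (hB N j _ _))//; [|lia|lia].
  by apply: surv_passage_le => //; lia.
have e1 := @profile_end N k J k0 ltac:(lia) kN.
have e2 := @invn_le_profile N k ltac:(lia).
have S0 : 0 <= B * S by rewrite !mulr_ge0// sumr_ge0.
have d1 : D * profile N (N - J).+1 <=
    `|D| * (Num.sqrt J%:R * Num.sqrt (N - k)%:R^-1 * profile N k).
  rewrite (le_trans (ler_norm _))// normrM (ger0_norm (profile_ge0 _ _)).
  by rewrite ler_wpM2l.
have d2 := ler_wpM2l S0 e2.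
rewrite (le_trans _ (lerD main last))//.
move: d1 d2; set e := Num.sqrt (N - k)%:R^-1; set f := profile N k.
set g := profile N (N - J).+1; set r := N%:R^-1.
move=> d1 d2; rewrite !mulrBl !mulrDl mulrBr; move: d1 d2; rewrite !mulrA; lra.
Qed.

End survival_asymptotics.

(** * Convergence of the mean excess *)

Section mean_excess.
Context {R : realType}.
Context (x : nat -> R) (x0 : x 0%N = 0) (xle : forall i, x i <= x i.+1).

(** The limit in N of the probability of a blackout of size i. *)
Definition blackout_prob i : R := surv x i i * expR (- x i.+1).

Lemma blackout_prob_ge0 i : 0 <= blackout_prob i.
Proof. by rewrite mulr_ge0 ?expR_ge0 ?surv_ge0. Qed.

(** For each N the weights of the histories killed at the first m levels add up
to at most 1; pass to the limit. *)
Lemma sum_blackout_prob_le1 m : \sum_(i < m) blackout_prob i <= 1.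
Proof.
pose q N i : R := surv x i i * ((N ^_ i)%:R / N%:R ^+ i *
  ((1 + - x i.+1 / N%:R) ^+ N / (1 + - x i.+1 / N%:R) ^+ i)).
have Noo : (fun N : nat => N) @ \oo --> \oo by exact: cvg_id.
have xN0 i : 1 + - x i.+1 / N%:R @[N --> \oo] --> (1 : R).
  rewrite -[X in _ --> X]addr0 -(mulr0 (- x i.+1)); apply: cvgD; first exact: cvg_cst.
  by apply: cvgM; [exact: cvg_cst|exact: (cvg_invn (R := R) (n := id) Noo)].
have qcvg : \sum_(i < m) q N i @[N --> \oo] --> \sum_(i < m) blackout_prob i.
  apply: cvg_sum => i; apply: cvgM; first exact: cvg_cst.
  have -> : expR (- x i.+1) = 1 * (expR (- x i.+1) / 1 ^+ i).
    by rewrite expr1n divr1 mul1r.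
  apply: cvgM; first exact: cvg_ffact.
  apply: cvgM; first by apply: cvg_expr_expR => //; exact: cvg_cst.
  by apply: cvgV; [rewrite expr1n oner_neq0|exact: cvg_expn].
apply: (ler_cvg_to qcvg (cvg_cst (1 : R))).
near=> N.
have N0 : 0 < N%:R :> R by rewrite ltr0n; near: N; exact: nbhs_infty_gt.
have mN : (m <= N)%N by near: N; exact: nbhs_infty_ge.
have xmN : x m < N%:R by near: N; exact: nbhs_infty_gtr.
have xmono i : (i <= m)%N -> x i <= x m.
  exact: (proj1 (nondecreasing_seqP x) xle).
have dN : 0 < dpow N N%:R :> R by rewrite /dpow divr_gt0 ?exprn_gt0// ltr0n fact_gt0.
rewrite -(ler_pM2r dN) mul1r mulr_suml.
have := sum_surv_kern x0 (leqW mN).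
have : 0 <= \sum_(c < N.+1) surv x m c * kern (N%:R - x m) c N.
  by apply: sumr_ge0 => c _; rewrite mulr_ge0 ?surv_ge0// kern_ge0// subr_ge0 ltW.
move=> + e; rewrite e subr_ge0; apply: le_trans; rewrite le_eqVlt; apply/orP; left.
apply/eqP; apply: eq_bigr => i _; rewrite /q -[LHS]mulrA; congr (_ * _).
have iN : (i <= N)%N by exact: leq_trans (ltnW (ltn_ord i)) mN.
rewrite /kern iN /dpow -(ffact_fact iN) natrM.
have xiN : 0 < 1 + - x i.+1 / N%:R.
  by rewrite mulNr subr_gt0 ltr_pdivrMr// mul1r (le_lt_trans _ xmN)// xmono.
have -> : N%:R - x i.+1 = N%:R * (1 + - x i.+1 / N%:R) by field; rewrite gt_eqF.
move: (1 + _) xiN => s s0.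
have -> : s ^+ N = s ^+ i * s ^+ (N - i) by rewrite -exprD subnKC.
have -> : N%:R ^+ N = N%:R ^+ i * N%:R ^+ (N - i) :> R by rewrite -exprD subnKC.
rewrite exprMn.
have h1 : s ^+ i != 0 by rewrite expf_neq0// gt_eqF.
have h2 : N%:R ^+ i != 0 :> R by rewrite expf_neq0// gt_eqF.
have h3 := @fact_neq0R R (N - i).
have h4 : (N ^_ i)%:R != 0 :> R by rewrite pnatr_eq0 -lt0n ffact_gt0.
by field; rewrite h1 h2 h3 h4.
Unshelve. all: by end_near. Qed.

Lemma mean_excessE m tau :
  mean_excess x m tau = tau - \sum_(i < m) blackout_prob i * (tau + i%:R - x i.+1).
Proof. by []. Qed.

Lemma mean_excessD m tau e :
  mean_excess x m (tau + e) = mean_excess x m tau + e * (1 - \sum_(i < m) blackout_prob i).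
Proof.
rewrite !mean_excessE mulrBr mulr1 mulr_sumr.
have -> : \sum_(i < m) blackout_prob i * (tau + e + i%:R - x i.+1) =
   \sum_(i < m) blackout_prob i * (tau + i%:R - x i.+1) + \sum_(i < m) e * blackout_prob i.
  by rewrite -big_split/=; apply: eq_bigr => i _; ring.
ring.
Qed.

Lemma mean_excess_homo m n tau : (m <= n)%N ->
  (forall i, (m <= i < n)%N -> tau + i%:R <= x i.+1) ->
  mean_excess x m tau <= mean_excess x n tau.
Proof.
move=> mn h; rewrite !mean_excessE lerD2l lerN2.
rewrite -!(big_mkord xpredT (fun i => blackout_prob i * (tau + i%:R - x i.+1))).
rewrite [leLHS](big_cat_nat (n := m))//= gerDl big_nat sumr_le0// => i mi.
by rewrite mulr_ge0_le0 ?blackout_prob_ge0// subr_le0 h.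
Qed.

(** Optional stopping bounds the mean excess below by the contribution of the
histories with count m at level m; it is read off from the limit in j of
[surv_passage_ge_survivor]. *)
Lemma mean_excess_gt0 m tau : (0 < m)%N -> 0 < x 1%N -> x m < tau + m%:R ->
  0 < mean_excess x m tau.
Proof.
move=> m0 x1 xm.
have Noo : (fun N : nat => N) @ \oo --> \oo by exact: cvg_id.
have c1 : surv_passage x m tau j / tree_weight j @[j --> \oo] --> expR tau * mean_excess x m tau.
  by apply: (cvg_surv_passage (j := id) (xt := fun=> x)) => // i _; exact: cvg_cst.
have c2 : passage tau j (x m) m / tree_weight j @[j --> \oo] -->
    expR (tau - x m) * (tau + m%:R - x m).
  by apply: (cvg_passage (j := id) (xt := fun=> x m)) => //; exact: cvg_cst.
have c3 : surv x m m * (passage tau j (x m) m / tree_weight j) @[j --> \oo] -->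
   surv x m m * (expR (tau - x m) * (tau + m%:R - x m)).
  by apply: cvgM; [exact: cvg_cst|exact: c2].
have le : surv x m m * (expR (tau - x m) * (tau + m%:R - x m)) <=
    expR tau * mean_excess x m tau.
  apply: (ler_cvg_to c3 c1); near=> j.
  rewrite mulrA ler_pM2r ?invr_gt0 ?tree_weight_gt0//.
  apply: surv_passage_ge_survivor => //; first exact: ltW.
  by near: j; exact: nbhs_infty_ge.
rewrite -(pmulr_rgt0 _ (expR_gt0 tau)); apply: lt_le_trans le.
rewrite mulr_gt0 ?mulr_gt0 ?expR_gt0 ?subr_gt0//.
by apply: surv_gt0.
Unshelve. all: by end_near. Qed.

(** With x i.+1 = theta + i + delta i.+1 the increments are
blackout_prob i * delta i.+1, an absolutely convergent series. For positivity,
the intercept is lowered to theta - 1/4, which does not increase the mean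
excess; from a level after which |delta| <= 1/4, that of the lowered intercept
is positive and nondecreasing. *)
Lemma mean_excess_cvg theta (delta : nat -> R) :
  (forall i, x i.+1 = theta + i%:R + delta i.+1) -> 0 < x 1%N ->
  delta i @[i --> \oo] --> (0 : R) ->
  exists2 v : R, 0 < v & mean_excess x m theta @[m --> \oo] --> v.
Proof.
move=> xE x1 d0.
have mean_excessE' m : mean_excess x m theta = theta + \sum_(i < m) blackout_prob i * delta i.+1.
  rewrite mean_excessE -sumrN; congr (_ + _); apply: eq_bigr => i _.
  by rewrite xE; ring.
have vcvg : cvgn (fun m => mean_excess x m theta).
  have : cvgn (series (fun i => blackout_prob i * delta i.+1)).
    apply: normed_cvg.
    have /cvg_seq_bounded[M [_ Mb]] : cvgn delta by apply/cvg_ex; exists 0.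
    have dM i : `|delta i| <= M + 1 by apply: Mb => //; rewrite ltrDl.
    have M0 : 0 <= M + 1 by exact: le_trans (dM 0%N).
    apply: nondecreasing_is_cvgn.
      by apply: nondecreasing_series => *; exact: normr_ge0.
    exists (M + 1) => _ [n _ <-]; rewrite /= seriesEord.
    apply: (@le_trans _ _ (\sum_(i < n) blackout_prob i * (M + 1))).
      apply: ler_sum => i _; rewrite normrM ger0_norm ?blackout_prob_ge0//.
      by rewrite ler_wpM2l ?blackout_prob_ge0.
    by rewrite -mulr_suml ler_piMl// sum_blackout_prob_le1.
  move=> /cvg_ex[l cl]; apply/cvg_ex; exists (theta + l).
  under eq_cvg do rewrite mean_excessE'.
  apply: cvgD; first exact: cvg_cst.
  rewrite (_ : (fun m => \sum_(i < m) blackout_prob i * delta i.+1) =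
               series (fun i => blackout_prob i * delta i.+1))//.
  by rewrite seriesEord.
have [m0 hm0] : exists m0, forall i, (m0 <= i)%N -> `|delta i| <= 4^-1.
  have /cvgrPdist_le /(_ 4^-1 ltac:(by rewrite invr_gt0)) := d0.
  by move=> [m0 _ h]; exists m0 => i mi; have := h i mi; rewrite /= sub0r normrN.
pose m := m0.+1; pose c := mean_excess x m (theta + - 4^-1).
have dm i : (m0 <= i)%N -> - 4^-1 <= delta i <= 4^-1.
  by move=> /hm0; rewrite ler_norml.
have c0 : 0 < c.
  apply: mean_excess_gt0 => //; rewrite /m xE -[m0.+1%:R]natr1.
  by have /andP[_ h] := dm m0.+1 (leqnSn _); lra.
exists (limn (fun m => mean_excess x m theta)) => //.
apply: lt_le_trans c0 _; apply: limr_ge => //; near=> n.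
have mn : (m <= n)%N by near: n; exact: nbhs_infty_ge.
apply: (@le_trans _ _ (mean_excess x n (theta + - 4^-1))).
  apply: mean_excess_homo => // i /andP[mi _]; rewrite xE.
  by have /andP[h _] := dm i.+1 (leqW (ltnW mi)); lra.
rewrite mean_excessD gerDl mulNr oppr_le0 mulr_ge0// subr_ge0.
exact: sum_blackout_prob_le1.
Unshelve. all: by end_near. Qed.

End mean_excess.

(** Convergence along all sequences i(N) <= k(N) that tend to infinity is uniform
smallness. Otherwise let b N be the largest index at which |D| exceeds e; b is
unbounded. The sequence that follows b at its records and k elsewhere tends to
infinity, since at every N it is at least the running maximum of b or k N. It
meets an index where |D| > e at each of the infinitely many records. *)
Lemma uniform_of_sequences (R : realType) (D : nat -> nat -> R) (k : nat -> nat) :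
  (forall N, (0 < N)%N -> (0 < k N <= N)%N) ->
  k N @[N --> \oo] --> \oo ->
  (forall i : nat -> nat,
     (forall N, (0 < N)%N -> (0 < i N <= k N)%N) ->
     i N @[N --> \oo] --> \oo -> D (i N) N @[N --> \oo] --> (0 : R)) ->
  forall e : R, 0 < e -> exists m, \forall N \near \oo,
    forall i, (m <= i <= k N)%N -> `|D i N| <= e.
Proof.
move=> krange koo Dseq e e0; apply: contrapT => bad.
pose b N : nat := \max_(i < (k N).+1 | e < `|D i N|) i.
pose rec N := [forall N' : 'I_N.+1, (b N' <= b N)%N].
pose i N := if rec N && (0 < b N)%N then b N else k N.
have b_unbounded M : exists N, (M <= N)%N /\ (M <= b N)%N /\ (0 < b N)%N.
  apply: contrapT => nb; apply: bad; exists M.+1; exists M => // N /= MN j /andP[Mj jk].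
  rewrite leNgt; apply/negP => ej; apply: nb; exists N; split => //.
  have jb : (j <= b N)%N.
    by apply: (@leq_bigmax_cond _ _ (fun i : 'I__ => nat_of_ord i)
      (Ordinal (jk : (j < (k N).+1)%N))).
  by split; lia.
have b_le N : (b N <= k N)%N.
  by apply/bigmax_leqP => j _; rewrite -ltnS.
have record N : exists N', (N <= N')%N /\ rec N' && (0 < b N')%N.
  pose B := \max_(n < N.+1) b n.
  have [N1 [_ [BN1 bN1]]] := b_unbounded (maxn N B).+1.
  pose a := [arg max_(n > ord0 : 'I_N1.+1) b n].
  have amax (n : 'I_N1.+1) : (b n <= b a)%N.
    by rewrite /a; case: arg_maxnP => // a' _ /(_ n isT).
  have ba : (B < b a)%N.
    by have := amax ord_max; rewrite /=; lia.
  exists a; split.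
    rewrite leqNgt; apply/negP => aN.
    have : (b a <= B)%N.
      by apply: (@leq_bigmax _ (fun n : 'I_N.+1 => b n) (Ordinal (ltnW aN : (a < N.+1)%N))).
    lia.
  apply/andP; split; last lia.
  apply/forallP => n; have nN1 : (n < N1.+1)%N by have := ltn_ord n; have := ltn_ord a; lia.
  exact: (amax (Ordinal nN1)).
have irange N : (0 < N)%N -> (0 < i N <= k N)%N.
  move=> N0; rewrite /i; case: ifP => [/andP[_ ->]|_]; first exact: b_le.
  by rewrite leqnn andbT; case/andP: (krange _ N0).
have ioo : i N @[N --> \oo] --> \oo.
  apply/cvgnyPge => M; have [N1 [_ [MN1 _]]] := b_unbounded M.
  near=> N; rewrite /i; case: ifP => [/andP[/forallP rN _]|_].
    have N1N : (N1 < N.+1)%N by rewrite ltnS; near: N; exact: nbhs_infty_ge.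
    by rewrite (leq_trans MN1)//; exact: (rN (Ordinal N1N)).
  by near: N; move/cvgnyPge : koo; apply.
have /cvgrPdist_le /(_ e e0) [N0 _ h] := Dseq i irange ioo.
have [N [N0N rN]] := record N0.
have := h N N0N; rewrite /= sub0r normrN /i rN; apply/negP; rewrite -ltNge.
have /andP[_ bN0] := rN.
pose A := [pred j : 'I_(k N).+1 | e < `|D j N|].
have bA : b N = (\max_(j in A) j)%N by apply: eq_bigl => j; rewrite inE.
have A0 : (0 < #|A|)%N.
  rewrite lt0n; apply: contraTneq bN0 => /card0_eq A0.
  by rewrite bA big_pred0.
rewrite bA; have [j jA ->] := eq_bigmax_cond (fun j : 'I_(k N).+1 => nat_of_ord j) A0.
by move: jA; rewrite inE.
Unshelve. all: by end_near. Qed.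

(** * The theorem *)

Lemma blackout_survival (R : realType) (N k : nat) (d : measure_display)
    (T : measurableType d) (P : probability T R) (C : 'I_N -> {RV P >-> R})
    (F : R -> R) (l x : nat -> R) :
  (k <= N)%N -> iid_with_cdf C F ->
  (forall i j, (0 < i)%N -> (i <= j <= N)%N -> l i <= l j) ->
  x 0%N = 0 -> (forall i, (0 < i <= N)%N -> F (l i) = x i / N%:R) ->
  fine (P [set t | (k <= blackout_size l (fun j => C j t))%N]) =
  survival x N k.
Proof.
move=> kN [indep cdfF] lmono x0 Fl.
rewrite (@probability_all_levels _ _ _ _ _ _ _ k x)//.
  move=> [|i] ik t //=; rewrite !in_itv/= => /le_trans; apply.
  by apply: lmono => //; lia.
move=> [|i] j // ik; rewrite -Fl; last by lia.
by rewrite -(cdfF j).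
Qed.

Lemma sqrt_ratio_profile (R : realType) (N k : nat) : (0 < k < N)%N ->
  Num.sqrt (k%:R * N%:R / (N%:R - k%:R)) = (profile N k)^-1 :> R.
Proof.
move=> /andP[k0 kN]; rewrite /profile -sqrtrV.
  congr Num.sqrt; have N0 : (0 < N)%N by exact: leq_trans kN.
  have h1 : N%:R != 0 :> R by rewrite pnatr_eq0 -lt0n.
  have h2 : k%:R != 0 :> R by rewrite pnatr_eq0 -lt0n.
  have h3 : N%:R - k%:R != 0 :> R by rewrite subr_eq0 eqr_nat gtn_eqF.
  by field; rewrite mulN1r h1 h2 h3.
by rewrite subr_ge0 lef_pV2 ?posrE ?ltr0n// ?ler_nat 1?ltnW// (leq_trans _ kN).
Qed.

Section affine_boundary.
Context {R : realType} (theta : R) (Delta : nat -> nat -> R) (delta : nat -> R).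

(** N times the distribution function at the i-th load level. Level 0, of mass 0,
is where the recursion starts. *)
Definition boundary N i : R :=
  if i is i'.+1 then theta + i'%:R + Delta i N else 0.

Definition limit_boundary i : R :=
  if i is i'.+1 then theta + i'%:R + delta i else 0.

Lemma cvg_boundary i :
  (forall i, (0 < i)%N -> Delta i N @[N --> \oo] --> delta i) ->
  boundary N i @[N --> \oo] --> limit_boundary i.
Proof.
case: i => [|i] Dd; first exact: cvg_cst.
by apply: cvgD; [exact: cvg_cst|exact: Dd].
Qed.

Lemma boundary_nondecreasing N i : 0 <= theta + Delta 1%N N ->
  (forall i, (0 < i)%N -> Delta i N - 1 <= Delta i.+1 N) ->
  boundary N i <= boundary N i.+1.
Proof.
move=> D1 Dstep; case: i => [|i] /=; first by rewrite addr0.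
have := Dstep i.+1 isT; rewrite -(natr1 i); lra.
Qed.

(** Sandwich with the intercepts theta + eps and theta - eps. The number
2 kappa + 2 collects the errors: 2 eps kappa for the mean excess (eps for the
intercept, eps for the level m) and 2 eps for the remainders. *)
Lemma survival_cvg (v sigma : R) (k : nat -> nat) :
  0 < sigma -> (@stirling R) n @[n --> \oo] --> sigma ->
  (forall i, boundary N i @[N --> \oo] --> limit_boundary i) ->
  (forall N i, (0 < N)%N -> boundary N i <= boundary N i.+1) ->
  mean_excess limit_boundary m theta @[m --> \oo] --> v ->
  (forall N, (0 < N)%N -> (0 < k N <= N)%N) ->
  k N @[N --> \oo] --> \oo -> (N - k N)%N @[N --> \oo] --> \oo ->
  (forall e : R, 0 < e -> exists m, \forall N \near \oo,
     forall i, (m <= i <= k N)%N -> `|Delta i N| <= e) ->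
  (profile N (k N))^-1 * survival (boundary N) N (k N) @[N --> \oo] -->
  2 / sigma * v.
Proof.
move=> sigma0 st xNx xNle vcvg k_range k_lim Nk_lim unif.
have xle i : limit_boundary i <= limit_boundary i.+1.
  apply: (ler_cvg_to (xNx i) (xNx i.+1)).
  by exists 1%N => // N /= N0; exact: xNle.
pose kappa := 2 / sigma; have kappa0 : 0 < kappa by rewrite divr_gt0.
apply/cvgrPdist_le => e e0.
pose eps := Num.min 4^-1 (e / (2 * kappa + 2)).
have k2 : 0 < 2 * kappa + 2 by lra.
have eps0 : 0 < eps by rewrite lt_min invr_gt0 divr_gt0// ltr0n.
have eps4 : eps <= 4^-1 by rewrite ge_min lexx.
have epse : (2 * kappa + 2) * eps <= e.
  by rewrite mulrC -ler_pdivlMr// ge_min lexx orbT.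
have [m1 {}unif] := unif _ eps0.
have [m2 _ vm2] : \forall m \near \oo, `|v - mean_excess limit_boundary m theta| <= eps.
  by move/cvgrPdist_le : vcvg; exact.
pose m := maxn m1 m2.
have vm : `|v - mean_excess limit_boundary m theta| <= eps.
  by apply: vm2; exact: leq_maxr.
have xx i : (i <= m)%N -> boundary N i @[N --> \oo] --> limit_boundary i by [].
have [J1 [C1 up]] := survival_upper (theta + eps) sigma0 st xx eps0.
have tt : theta + - eps <= theta + eps by lra.
have [J2 [C2 lo]] := survival_lower sigma0 st xx eps0 tt.
have sq0 (c : R) : c * Num.sqrt (N - k N)%:R^-1 @[N --> \oo] --> (0 : R).
  rewrite -(mulr0 c) -(sqrtr0 R); apply: cvgM; first exact: cvg_cst.
  by apply: continuous_cvg; [exact: sqrt_continuous|exact: cvg_invn].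
have near1 : \forall N \near \oo, C1 * Num.sqrt (N - k N)%:R^-1 < eps.
  exact: (cvgr_lt _ (sq0 C1) _ eps0).
have near2 : \forall N \near \oo, C2 * Num.sqrt (N - k N)%:R^-1 < eps.
  exact: (cvgr_lt _ (sq0 C2) _ eps0).
near=> N.
have N0 : (0 < N)%N by near: N; exact: nbhs_infty_gt.
have unifN : forall i, (m1 <= i <= k N)%N -> `|Delta i N| <= eps by near: N.
have J1k : (J1 <= k N)%N by near: N; exact: near_ge.
have J2k : (J2 <= k N)%N by near: N; exact: near_ge.
have J1N : (J1 <= N - k N)%N by near: N; exact: near_ge.
have J2N : (J2 <= N - k N)%N by near: N; exact: near_ge.
have Nk : (0 < N - k N)%N by near: N; exact: near_ge.
have kN : (0 < k N < N)%N by case/andP: (k_range N N0) => -> _ /=; rewrite -subn_gt0.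
have C1e : C1 * Num.sqrt (N - k N)%:R^-1 < eps by near: N.
have C2e : C2 * Num.sqrt (N - k N)%:R^-1 < eps by near: N.
have f0 := @profile_gt0 R _ _ kN.
have Db i : (m <= i < k N)%N -> - eps <= Delta i.+1 N <= eps.
  move=> /andP[mi ik]; rewrite -ler_norml unifN// ik andbT leqW//.
  exact: leq_trans (leq_maxl m1 m2) mi.
have h1 : survival (boundary N) N (k N) <=
    (kappa * mean_excess limit_boundary m (theta + eps) + eps +
     C1 * Num.sqrt (N - k N)%:R^-1) * profile N (k N).
  apply: up => // [i _|i /Db /andP[_]]; first exact: xNle.
  by rewrite /boundary => h; rewrite addrAC lerD2r lerD2l.
have h2 : (kappa * mean_excess limit_boundary m (theta + - eps) - eps -
     C2 * Num.sqrt (N - k N)%:R^-1) * profile N (k N) <=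
    survival (boundary N) N (k N).
  apply: lo => // [i _|i /Db /andP[h h']|i /Db /andP[_ h]]; first exact: xNle.
    clear -h h' eps4; rewrite /boundary -(natr1 i); apply/andP; split; lra.
  by rewrite /boundary addrAC lerD2r lerD2l.
have pm := sum_blackout_prob_le1 erefl xle m.
have pm0 : 0 <= \sum_(i < m) blackout_prob limit_boundary i.
  by apply: sumr_ge0 => i _; exact: blackout_prob_ge0.
rewrite [(profile _ _)^-1 * _]mulrC -/kappa.
move: h1 h2 C1e C2e vm; rewrite !mean_excessD -(ler_pdivrMr _ _ f0) -(ler_pdivlMr _ _ f0).
move: pm pm0; move: (\sum_(i < m) _) (mean_excess limit_boundary m theta) => p dm.
move: (C1 * _) (C2 * _) (survival _ _ _ / _) => a b s.
clear -kappa0 eps0 epse => pm pm0 h1 h2 ae be; rewrite !ler_norml => /andP[v1 v2].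
have q1 : eps * (1 - p) <= eps by rewrite ger_pMr//; lra.
have q0 : 0 <= eps * (1 - p) by rewrite mulr_ge0 ?subr_ge0// ltW.
have r1 : kappa * (dm + eps * (1 - p)) <= kappa * (v + 2 * eps).
  by rewrite ler_pM2l//; lra.
have r2 : kappa * (v - 2 * eps) <= kappa * (dm + - eps * (1 - p)).
  by rewrite ler_pM2l// mulNr; lra.
have r3 : kappa * (v + 2 * eps) = kappa * v + 2 * (kappa * eps) by ring.
have r4 : kappa * (v - 2 * eps) = kappa * v - 2 * (kappa * eps) by ring.
have r5 : (2 * kappa + 2) * eps = 2 * (kappa * eps) + 2 * eps by ring.
rewrite r3 in r1; rewrite r4 in r2; rewrite r5 in epse.
by apply/andP; split; lra.
Unshelve. all: by end_near. Qed.

End affine_boundary.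

Unset Implicit Arguments.
Set Strict Implicit.
Set Printing Implicit Defensive.

Theorem theorem3 (R : realType) (theta : R) (Delta : nat -> nat -> R)
    (delta : nat -> R)
    (theta_gt0 : 0 < theta)
    (Delta_range : forall i N : nat, (0 < i)%N -> (0 < N)%N ->
       - (theta + i%:R - 1) <= Delta i N <= N%:R - (theta + i%:R - 1))
    (Delta_step : forall N i : nat, (0 < N)%N -> (0 < i)%N ->
       Delta i N - 1 <= Delta i.+1 N)
    (Delta_lim : forall i : nat, (0 < i)%N ->
       Delta i N @[N --> \oo] --> delta i)
    (delta_lim : delta i @[i --> \oo] --> (0 : R))
    (nondegenerate : - theta < delta 1%N) :
  exists2 V : R, 0 < V &
    forall (k : nat -> nat)
      (k_range : forall N : nat, (0 < N)%N -> (0 < k N <= N)%N)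
      (k_lim : k N @[N --> \oo] --> \oo)
      (Nk_lim : (N - k N)%N @[N --> \oo] --> \oo)
      (Delta_unif : forall i : nat -> nat,
         (forall N : nat, (0 < N)%N -> (0 < i N <= k N)%N) ->
         i N @[N --> \oo] --> \oo ->
         Delta (i N) N @[N --> \oo] --> (0 : R))
      (F : R -> R) (F_cont : continuous F)
      (F_dens : positive_density_at_zero F)
      (l : nat -> nat -> R)
      (l_incr : forall N i j : nat, (0 < i)%N -> (i <= j <= N)%N ->
         l N i <= l N j)
      (F_l : forall N i : nat, (0 < i <= N)%N ->
         F (l N i) = (theta + i%:R - 1 + Delta i N) / N%:R)
      (d : nat -> measure_display)
      (T : forall N : nat, measurableType (d N))
      (P : forall N : nat, probability (T N) R)
      (C : forall N : nat, 'I_N -> {RV (P N) >-> R})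
      (C_iid : forall N : nat, (0 < N)%N -> iid_with_cdf (C N) F),
    Num.sqrt ((k N)%:R * N%:R / (N%:R - (k N)%:R)) *
      fine (P N [set t | (k N <= blackout_size (l N) (fun j => C N j t))%N])
      @[N --> \oo] --> V.
Proof.
have cvgb i := @cvg_boundary R theta Delta delta i Delta_lim.
have ble N i : (0 < N)%N -> boundary theta Delta N i <= boundary theta Delta N i.+1.
  move=> N0; apply: boundary_nondecreasing => [|j j0]; last exact: Delta_step.
  by have /andP[h _] := Delta_range 1%N N isT N0; lra.
have xle i : limit_boundary theta delta i <= limit_boundary theta delta i.+1.
  apply: (ler_cvg_to (cvgb i) (cvgb i.+1)).
  by exists 1%N => // N /= N0; exact: ble.
have x1 : 0 < limit_boundary theta delta 1%N by rewrite /limit_boundary addr0; lra.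
have [v v0 vcvg] := @mean_excess_cvg R _ erefl xle theta delta (fun i => erefl) x1 delta_lim.
have [sigma sigma0 st] := @stirling_cvg R.
exists (2 / sigma * v); first by rewrite mulr_gt0// divr_gt0.
move=> k k_range k_lim Nk_lim Delta_unif F _ _ l l_incr F_l d T P C C_iid.
have := survival_cvg sigma0 st cvgb ble vcvg k_range k_lim Nk_lim
  (uniform_of_sequences k_range k_lim Delta_unif).
apply: cvg_trans; apply: near_eq_cvg; near=> N.
have N0 : (0 < N)%N by near: N; exact: nbhs_infty_gt.
have Nk : (0 < N - k N)%N by near: N; exact: near_ge.
have kN : (0 < k N < N)%N by case/andP: (k_range N N0) => -> _ /=; rewrite -subn_gt0.
rewrite (sqrt_ratio_profile R kN).
rewrite (@blackout_survival R N (k N) _ _ (P N) (C N) F (l N) (boundary theta Delta N))//.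
- by case/andP: kN => _ /ltnW.
- exact: C_iid.
- exact: l_incr.
- move=> [//|i] iN; rewrite F_l// /boundary -(natr1 i); congr (_ / _); ring.
Unshelve. all: by end_near. Qed.
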